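(* Let $0<\alpha<r$ and let $\hat s^{(st)}_{\hat m}$ be the model selection estimator associated with the model collections $\mathcal{M}^{(s)}_n$. Assume that $(\lambda_n)_n$ is a non-decreasing sequence of positive numbers with $\lim_{n\to+\infty}n^{-1}\lambda_n=0$, that there exist $n_0\in\mathbb{N}^*$ and $0<\delta\le\frac12$ such that $\lambda_{2n}\le2(1-\delta)\lambda_n$ for every $n\ge n_0$, and that there exist $\kappa>1$ and $0<p<1$ such that for every $n$ $$\sum_{m\in\mathcal{M}^{(s)}_n}e^{-\frac{(\sqrt{\kappa^{-1}\lambda_n}-1)^2D_m}{2}}\le\sqrt{1-p}.$$ Then $$MS(\hat s^{(st)}_{\hat m},\rho_\alpha):=:\mathcal{B}^\alpha_{2,\infty}.$$
   Context: Gaussian white noise model on $[0,1]$: $s\in\mathbb{L}_2([0,1])$ is unknown, $\|\cdot\|$ is the $\mathbb{L}_2([0,1])$ norm, and for $n\in\mathbb{N}^*=\{1,2,\dots\}$ one observes, for all $u\in\mathbb{L}_2([0,1])$, $Y_n(u)=\int_0^1u(t)s(t)\,dt+\frac{1}{\sqrt n}W_u$, where $(W_u)$ is a centered Gaussian process with $\mathbb{E}[W_uW_{u'}]=\int_0^1u(t)u'(t)\,dt$. Wavelets: $\phi,\psi$ are a compactly supported scaling function and wavelet whose dilates/translates $\phi_{jk}(x)=2^{j/2}\phi(2^jx-k)$, $\psi_{jk}(x)=2^{j/2}\psi(2^jx-k)$, once periodized, give an orthonormal basis $\Psi=\{\phi_{00},\psi_{jk}:j\ge0,\ 0\le k\le2^j-1\}$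 of $\mathbb{L}_2([0,1])$; the associated multiresolution analysis is $r$-regular (in the sense of Meyer) with $r\ge1$. Write $s=\alpha_{00}\phi_{00}+\sum_{j\ge0}\sum_{k=0}^{2^j-1}\beta_{jk}\psi_{jk}$. Models: $\mathcal{M}^{(s)}=\{m=\mathrm{span}\{\phi_{00},\psi_{jk}:j<N_m,\ 0\le k<2^j\}:\ N_m\in\mathbb{N}\}$, $\mathbb{N}=\{0,1,2,\dots\}$; the maximal resolution level $j_0(n)$, non-decreasing in $n$, is given by $2^{j_0(n)}\le n\lambda_n^{-1}<2^{j_0(n)+1}$; $\mathcal{M}^{(s)}_n=\{m\in\mathcal{M}^{(s)}:N_m<j_0(n)\}$ (values of $n$ for which this is empty are ignored). $D_m$ is the dimension of $m$. For a model $m$, $\hat s_m$ minimizes $\gamma_n(u)=-2Y_n(u)+\|u\|^2$ over $u\in m$; the model selection estimator associated with collections $\mathcal{M}_n$ is $\hat s_{\hat m}$ with $\hat m=\arg\min_{m\in\mathcal{M}_n}\{\gamma_n(\hat s_m)+\frac{\lambda_n}{n}D_m\}$. Notation: $\rho_\alpha=(\rho_{n,\alpha})_n$, $\rho_{n,\alpha}=\left(\frac{\lambda_n}{n}\right)^{\frac{\alpha}{1+2\alpha}}$. $\mathcal{B}^\alpha_{2,\infty}$ is the (periodic) Besov space $\{s\in\mathbb{L}_2([0,1]):\sup_{J\in\mathbb{N}}2^{2J\alpha}\sum_{k=0}^{2^J-1}\beta_{Jk}^2<\infty\}$, with balls given by bounding this supremum. Maxisets: for an estimator $\hat s$, $MS(\hat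 s,\rho_\alpha)=\{s\in\mathbb{L}_2([0,1]):\sup_n\{\rho_{n,\alpha}^{-2}\mathbb{E}[\|\hat s-s\|^2]\}<\infty\}$, and its ball $MS(\hat s,\rho_\alpha)(R)$ is the set of $s$ for which this supremum is $\le R^2$. $MS(\hat s,\rho_\alpha):=:\mathcal{F}$ means: for every $R>0$ there is $R'>0$ with $MS(\hat s,\rho_\alpha)(R)\subset\mathcal{F}(R')$, and for every $R'>0$ there is $R>0$ with $\mathcal{F}(R')\subset MS(\hat s,\rho_\alpha)(R)$. *)

(* Defs.v *)
From mathcomp Require Export all_boot all_order all_algebra.
From mathcomp Require Export all_classical all_reals all_analysis.

Set Implicit Arguments.
Unset Strict Implicit.
Unset Printing Implicit Defensive.
Import Order.TTheory GRing.Theory Num.Theory.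
Import numFieldNormedType.Exports.

Local Open Scope classical_set_scope.
Local Open Scope ring_scope.

(* Elements of an L2 space are represented by functions T -> R; equality in L2
   is equality mu-almost everywhere. *)

Section hilbert.
Context {d : measure_display} {T : measurableType d} {R : realType}.
Variable mu : {measure set T -> \bar R}.

Definition L2 : set (T -> R) := [set f | f \in Lfun mu 2%:E].

Definition L2norm (f : T -> R) : R := fine ('N[mu]_2%:E[EFin \o f])%E.

Definition dotp (f g : T -> R) : R := (\int[mu]_x (f x * g x))%R.

(* The linear combinations are taken pointwise, not up to a.e. equality. *)
Definition span (S : set (T -> R)) : set (T -> R) :=
  [set f | exists (n : nat) (c : 'I_n -> R) (e : 'I_n -> T -> R),
     (forall i, S (e i)) /\ f = fun x => \sum_(i < n) c i * e i x].

Definition free_family (n : nat) (e : 'I_n -> T -> R) : Prop :=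
  forall c : 'I_n -> R,
    {ae mu, forall x, \sum_(i < n) c i * e i x = 0} -> forall i, c i = 0.

(* the number of elements of a basis of V; 0 if V has no finite basis *)
Definition dimension (V : set (T -> R)) : nat :=
  xget 0%N [set n | exists e : 'I_n -> T -> R,
    free_family e /\ V = span (range e)].

Definition dense_in (D V : set (T -> R)) : Prop :=
  forall f, V f -> forall eps : R, 0 < eps ->
    exists2 g, D g & L2norm (f \- g) < eps.

Definition orthonormal_basis (V : set (T -> R)) (I : eqType)
    (e : I -> T -> R) : Prop :=
  [/\ forall i, V (e i),
      forall i j, dotp (e i) (e j) = (i == j)%:R &
      dense_in (span (range e)) V].

(* In particular a closed subspace is stable under a.e. equality. *)
Definition closed_subspace (V : set (T -> R)) : Prop :=
  [/\ V `<=` L2,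
      V (cst 0),
      forall a b f g, V f -> V g -> V (fun x => a * f x + b * g x) &
      forall f, L2 f ->
        (forall eps : R, 0 < eps -> exists2 g, V g & L2norm (f \- g) < eps) ->
        V f].

End hilbert.

Section multiresolution.
Context {R : realType}.

Definition leb : {measure set (measurableTypeR R) -> \bar R} :=
  @lebesgue_measure R.

Definition translates (g : R -> R) (k : int) : R -> R := fun x => g (x - k%:~R).

Definition riesz_basis_of_translates (V : set (R -> R)) (g : R -> R) : Prop :=
  [/\ forall k, V (translates g k),
      dense_in leb (span (range (translates g))) V &
      exists A B : R, [/\ 0 < A, 0 < B &
        forall (n : nat) (k : 'I_n -> int) (c : 'I_n -> R), injective k ->
          let f := fun x => \sum_(i < n) c i * translates g (k i) x in
          A * \sum_(i < n) c i ^+ 2 <= L2norm leb f ^+ 2 /\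
          L2norm leb f ^+ 2 <= B * \sum_(i < n) c i ^+ 2]].

Definition compactly_supported (f : R -> R) : Prop :=
  exists A : R, forall x, A < `|x| -> f x = 0.

Definition test_function (theta : R -> R) : Prop :=
  compactly_supported theta /\
  forall (k : nat) (x : R), derivable (derive1n k theta) x 1.

(* h is the k-th derivative of g in the sense of distributions *)
Definition weak_derivative (k : nat) (g h : R -> R) : Prop :=
  forall theta, test_function theta ->
    (\int[leb]_x (g x * derive1n k theta x) =
     (-1) ^+ k * \int[leb]_x (h x * theta x))%R.

Definition rapidly_decreasing_up_to (r : nat) (g : R -> R) : Prop :=
  forall k : nat, (k <= r)%N -> exists h : R -> R,
    [/\ measurable_fun [set: measurableTypeR R] (h : _ -> measurableTypeR R),
        weak_derivative k g h &
        forall m : nat, exists C : R,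
          {ae leb, forall x, `|h x| <= C * (1 + `|x|) ^- m}].

(* multiresolution analyses and their regularity, in the sense of Meyer: as in
   his definition, the derivatives are taken in the distribution sense (the one
   of order r need not be continuous) and the generator g of the Riesz basis
   need not be the (orthonormal) scaling function *)
Definition multiresolution_analysis (V : int -> set (R -> R)) : Prop :=
  [/\ (forall j, closed_subspace leb (V j)) /\ (forall j, V j `<=` V (j + 1)),
      forall f, (forall j, V j f) -> {ae leb, forall x, f x = 0},
      dense_in leb (\bigcup_j V j) (L2 leb),
      (forall j f, V j f <-> V (j + 1) (fun x => f (2 * x))) /\
      (forall (k : int) f, V 0 f <-> V 0 (fun x => f (x - k%:~R))) &
      exists g, riesz_basis_of_translates (V 0) g].

Definition regular_mra (r : nat) (V : int -> set (R -> R)) : Prop :=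
  multiresolution_analysis V /\
  exists g, riesz_basis_of_translates (V 0) g /\ rapidly_decreasing_up_to r g.

Definition scaling_function (V : int -> set (R -> R)) (phi : R -> R) : Prop :=
  orthonormal_basis leb (V 0) (translates phi).

(* the integer translates of psi form an orthonormal basis of the orthogonal
   complement of V 0 in V 1 *)
Definition mother_wavelet (V : int -> set (R -> R)) (psi : R -> R) : Prop :=
  orthonormal_basis leb [set f | V 1 f /\ forall g, V 0 g -> dotp leb f g = 0]
    (translates psi).

End multiresolution.

Section periodized_wavelets.
Context {R : realType}.

(* L2 ([0,1]) is thus represented by functions on R, considered on [0,1] only. *)
Definition leb01 : {measure set (measurableTypeR R) -> \bar R} :=
  mrestr (@leb R) (measurable_itv `[0%R, 1%R]).

Definition dilate (j k : nat) (f : R -> R) : R -> R :=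
  fun x => 2 `^ (j%:R / 2) * f (2 ^+ j * x - k%:R).

(* For compactly supported f the sum has finitely many nonzero terms. *)
Definition periodize (f : R -> R) : R -> R :=
  fun x => \sum_(l \in [set: int]) f (x + l%:~R).

(* None indexes phi_00; Some (j, k), with k < 2 ^ j, indexes psi_jk *)
Definition windex : eqType := option {j : nat & 'I_(2 ^ j)}.

Definition wave (phi psi : R -> R) (i : windex) : R -> R :=
  match i with
  | None => periodize (dilate 0 0 phi)
  | Some jk => periodize (dilate (tag jk) (tagged jk) psi)
  end.

Record wavelet_setting (r : nat) (phi psi : R -> R) : Prop := {
  phi_compact : compactly_supported phi;
  psi_compact : compactly_supported psi;
  wavelet_mra : exists V : int -> set (R -> R),
    [/\ regular_mra r V, scaling_function V phi & mother_wavelet V psi];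
  wave_basis : orthonormal_basis leb01 (L2 leb01) (wave phi psi) }.

Definition below (N : nat) (i : windex) : Prop :=
  match i with None => True | Some jk => (tag jk < N)%N end.

Definition model (phi psi : R -> R) (N : nat) : set (R -> R) :=
  span (wave phi psi @` [set i | below N i]).

Definition model_dim (phi psi : R -> R) (N : nat) : nat :=
  dimension leb01 (model phi psi N).

(* Models are represented by their level N_m. *)
Definition collection (j0 : int) : set nat := [set N : nat | N%:Z < j0].

Definition beta (phi psi s : R -> R) (J : nat) (k : 'I_(2 ^ J)) : R :=
  dotp leb01 s (wave phi psi (Some (Tagged (fun j => 'I_(2 ^ j)) k))).

Definition besov_ball (phi psi : R -> R) (alpha M : R) : set (R -> R) :=
  [set s | L2 leb01 s /\
    (ereal_sup (range (fun J : nat =>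
       (2 `^ (2 * J%:R * alpha) *
        \sum_(k < 2 ^ J) beta phi psi s k ^+ 2)%:E))
     <= (M ^+ 2)%:E)%E].

End periodized_wavelets.

Section white_noise.
Context {d : measure_display} {Omega : measurableType d} {R : realType}.
Variable P : probability Omega R.

(* Constants are treated apart: normal_prob with zero deviation is not a Dirac
   mass in the library. *)
Definition gaussian_variable (X : Omega -> R) : Prop :=
  (exists c : R, {ae P, forall w, X w = c}) \/
  (exists m sigma : R, sigma != 0 /\
    forall A : set (measurableTypeR R), measurable A ->
      P (X @^-1` A) = normal_prob m sigma A).

Definition gaussian_process (W : (R -> R) -> {RV P >-> R}) : Prop :=
  forall (n : nat) (u : 'I_n -> R -> R) (a : 'I_n -> R),
    (forall i, L2 leb01 (u i)) ->
    gaussian_variable (fun w => \sum_(i < n) a i * W (u i) w).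

Definition linear_on_span (S : set (R -> R)) (y : (R -> R) -> R) : Prop :=
  forall (a b : R) (u v : R -> R), span S u -> span S v ->
    y (fun x => a * u x + b * v x) = a * y u + b * y v.

(* The covariance only gives linearity of u |-> W u up to a null set depending
   on the combination; noise_linear selects the usual version of W, linear on
   the (countable-dimensional) span of Psi.  Without it the contrast may have no
   minimizer on a model. *)
Record white_noise (Psi : set (R -> R)) (W : (R -> R) -> {RV P >-> R}) : Prop := {
  noise_gaussian : gaussian_process W;
  noise_centered : forall u : R -> R, L2 leb01 u -> ('E_P[W u] = 0)%E;
  noise_cov : forall u v : R -> R, L2 leb01 u -> L2 leb01 v ->
    ('E_P[fun w => (W u w * W v w)%R] = (dotp leb01 u v)%:E)%E;
  noise_linear : forall w, linear_on_span Psi (fun u => W u w) }.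

Definition observation (W : (R -> R) -> {RV P >-> R}) (n : nat) (s : R -> R)
    (w : Omega) : (R -> R) -> R :=
  fun u => dotp leb01 u s + (Num.sqrt n%:R)^-1 * W u w.

(* An estimator is a function of the sample size and of the observation. *)
Definition estimator : Type := nat -> ((R -> R) -> R) -> (R -> R).

Definition risk (W : (R -> R) -> {RV P >-> R}) (shat : estimator) (n : nat)
    (s : R -> R) : \bar R :=
  ('E_P[fun w => (L2norm leb01 (shat n (observation W n s w) \- s) ^+ 2)%R])%E.

(* dom is the set of the values of n over which the supremum is taken *)
Definition maxiset_ball (W : (R -> R) -> {RV P >-> R}) (dom : set nat)
    (shat : estimator) (rho : nat -> R) (M : R) : set (R -> R) :=
  [set s | L2 leb01 s /\
    (ereal_sup [set ((rho n) ^- 2)%:E * risk W shat n s | n in dom]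
     <= (M ^+ 2)%:E)%E].

Definition same_balls (F G : R -> set (R -> R)) : Prop :=
  (forall M, 0 < M -> exists M', 0 < M' /\ F M `<=` G M') /\
  (forall M', 0 < M' -> exists M, 0 < M /\ G M' `<=` F M).

End white_noise.

Section model_selection.
Context {R : realType}.
Variables phi psi : R -> R.

Definition argmin (T : Type) (A : set T) (F : T -> R) : set T :=
  [set x | A x /\ forall y, A y -> F x <= F y].

Definition contrast (y : (R -> R) -> R) (u : R -> R) : R :=
  - 2 * y u + L2norm leb01 u ^+ 2.

Definition model_estimator (N : nat) (y : (R -> R) -> R) : R -> R :=
  xget (cst 0) (argmin (model phi psi N) (contrast y)).

Definition penalized (lambda : nat -> R) (n : nat) (y : (R -> R) -> R)
    (N : nat) : R :=
  contrast y (model_estimator N y) + lambda n / n%:R * (model_dim phi psi N)%:R.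

(* the sample sizes for which there is at least one model *)
Definition sizes (j0 : nat -> int) : set nat :=
  [set n | (1 <= n)%N /\ collection (j0 n) !=set0].

Definition selection_rule (lambda : nat -> R) (j0 : nat -> int)
    (mhat : nat -> ((R -> R) -> R) -> nat) : Prop :=
  forall n y, sizes j0 n ->
    argmin (collection (j0 n)) (penalized lambda n y) (mhat n y).

Definition selected_estimator (mhat : nat -> ((R -> R) -> R) -> nat)
    : nat -> ((R -> R) -> R) -> (R -> R) :=
  fun n y => model_estimator (mhat n y) y.

Definition rate (lambda : nat -> R) (alpha : R) (n : nat) : R :=
  (lambda n / n%:R) `^ (alpha / (1 + 2 * alpha)).

End model_selection.

(* Main.v *)
Require Import Defs.
From mathcomp Require Import all_boot all_order all_algebra.
From mathcomp Require Import all_classical all_reals all_analysis.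
From mathcomp Require Import measurable_realfun zify ring lra.
Import Order.TTheory GRing.Theory Num.Theory.
Import numFieldNormedType.Exports.
Set Implicit Arguments.
Unset Strict Implicit.
Unset Printing Implicit Defensive.
Local Open Scope classical_set_scope.
Local Open Scope ring_scope.

(** Through the contrast, the estimator only sees the noisy coefficients
[theta_i + eps_i / sqrt n] of [s] in the wavelet basis, and the model of level
[N] keeps those of the levels below [N]. Its loss is the energy of the missed
coefficients, [bias s N], plus that of the noise it keeps ([loss_model]).
Up to constants, to belong to a Besov ball is to have [bias s N] bounded by a
multiple of [2 ^ (- 2 alpha N)], so that both inclusions are statements about
this sequence. Write [u = lambda n / n]; the squared rate is then [u ^ g] with
[g = 2 alpha / (1 + 2 alpha)].

From a Besov ball to a maxiset ball, an oracle inequality ([risk_oracle])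
bounds the risk, up to a constant factor, by [bias s N + u 2 ^ N] for every
level [N] of the collection, plus a remainder of the order of [j0 n / n]; the
level that balances the bias and the penalty gives the rate ([oracle_rate]).

Conversely, a small risk means that the selected bias is small, but it
controls the selected dimension only up to a factor [lambda n], because it
contains the variance and not the penalty. Instead, for each large [n] there is an
outcome on which the selected level [N_n] has a bias of the order of the risk
and costs, in penalty, no more than any given level [N'] plus a multiple of
[bias s N'] ([good_outcome]). Taking for [N'] the level obtained at [n] when the
sample size is [2 n] yields a recursion on [u 2 ^ N_n]; the condition
[lambda (2 n) <= 2 (1 - delta) lambda n] makes it a contraction at the scale
[u ^ g] ([dimension_rate]). Hence [2 ^ N_n] is at most of the order of
[u ^ (- 1 / (1 + 2 alpha))] along a geometric sequence of sizes, and since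
[bias s] is nonincreasing this bounds it at every level ([bias_rate]).

The noise enters through moments only. The fourth moments of sums of two noise
coefficients show that their squares are uncorrelated, so that the energy of a
level has a variance proportional to its mean ([chi_square_variance]).
Chebyshev's inequality is then strong enough, because the exponential sums
being less than [1] forces [lambda n > 4 kappa] as soon as three models compete
([penalty_lower_bound]). The same sums show that at some size the model of
level [0] is alone ([j0_eq1]); there the risk bounds the whole of [bias s 0],
and this is what controls the first levels uniformly over a maxiset ball. *)

(* the span of a set of functions, not that of a sequence of vectors *)
Local Notation span := Defs.span.

(** * Square-integrable functions *)

Section l2.
Context {d : measure_display} {T : measurableType d} {R : realType}.
Variable mu : {measure set T -> \bar R}.
Implicit Types f g h : T -> R.

Lemma L2_linear a b f g : L2 mu f -> L2 mu g ->
  L2 mu (fun x => a * f x + b * g x).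
Proof.
rewrite /L2 /= => Lf Lg.
have Laf : (fun x => a * f x) \in Lfun mu 2%:E.
  rewrite (_ : (fun x => a * f x) = a \o* f); last by apply/funext => x /=; rewrite mulrC.
  by apply: Lfun_scale => //; rewrite ler1n.
have Lbg : (fun x => b * g x) \in Lfun mu 2%:E.
  rewrite (_ : (fun x => b * g x) = b \o* g); last by apply/funext => x /=; rewrite mulrC.
  by apply: Lfun_scale => //; rewrite ler1n.
have p1 : (1 <= (2%:E : \bar R))%E by rewrite lee_fin ler1n.
by rewrite /=; apply: (@Lfun_addr_closed _ _ _ mu 2%:E p1).2.
Qed.

Lemma L2_cst0 : L2 mu (cst 0).
Proof.
have p1 : (1 <= (2%:E : \bar R))%E by rewrite lee_fin ler1n.
exact: (@Lfun_addr_closed _ _ _ mu 2%:E p1).1.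
Qed.

Lemma L2_sum (I : Type) (s : seq I) (c : I -> R) (e : I -> T -> R) :
  (forall i, L2 mu (e i)) -> L2 mu (fun x => \sum_(i <- s) c i * e i x).
Proof.
move=> Le; elim: s => [|i s IH].
  by under eq_fun do rewrite big_nil; exact: L2_cst0.
under eq_fun do rewrite big_cons -[\sum_(_ <- _) _]mul1r.
exact: L2_linear.
Qed.

Lemma L2_mul_integrable f g : L2 mu f -> L2 mu g ->
  mu.-integrable setT (EFin \o (fun x => f x * g x)).
Proof. by move=> Lf Lg; apply/Lfun1_integrable; exact: Lfun2_mul_Lfun1. Qed.

Lemma dotpC f g : dotp mu f g = dotp mu g f.
Proof. by congr fine; apply: eq_integral => x _; rewrite mulrC. Qed.

Lemma dotp_linearl a b f g h : L2 mu f -> L2 mu g -> L2 mu h ->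
  dotp mu (fun x => a * f x + b * g x) h = a * dotp mu f h + b * dotp mu g h.
Proof.
move=> Lf Lg Lh; rewrite /dotp.
rewrite (@eq_Rintegral _ _ _ mu _ (fun x => a * (f x * h x) + b * (g x * h x))); last first.
  by move=> x _; rewrite mulrDl !mulrA.
have iZ c k : L2 mu k -> mu.-integrable setT (EFin \o (fun x => c * (k x * h x))).
  move=> Lk; have := integrableZl measurableT c (L2_mul_integrable Lk Lh).
  by apply: eq_integrable => // x _; rewrite /= EFinM.
by rewrite RintegralD ?iZ // !RintegralZl //; exact: L2_mul_integrable.
Qed.

Lemma dotp_suml (I : Type) (s : seq I) (c : I -> R) (e : I -> T -> R) h :
  (forall i, L2 mu (e i)) -> L2 mu h ->
  dotp mu (fun x => \sum_(i <- s) c i * e i x) h = \sum_(i <- s) c i * dotp mu (e i) h.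
Proof.
move=> Le Lh; elim: s => [|i s IH].
  rewrite big_nil /dotp (@eq_Rintegral _ _ _ mu _ (cst 0)); last by move=> x _; rewrite big_nil mul0r.
  by rewrite /Rintegral integral0.
rewrite big_cons -IH -[X in _ + X]mul1r -dotp_linearl //; last exact: L2_sum.
by congr dotp; apply/funext => x; rewrite big_cons mul1r.
Qed.

Lemma L2norm_sqr f : L2norm mu f ^+ 2 = dotp mu f f.
Proof.
rewrite /L2norm -powR_mulrn ?fine_ge0 ?Lnorm_ge0 //.
rewrite -fine_poweR poweR_Lnorm; last by rewrite pnatr_eq0.
congr fine; apply: eq_integral => x _ /=.
by rewrite powR_mulrn ?normr_ge0 // real_normK ?num_real // expr2.
Qed.

Lemma L2norm_lt_sqr f eps : 0 < eps -> L2norm mu f < eps -> dotp mu f f < eps ^+ 2.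
Proof.
move=> e0 fe; have n0 : 0 <= L2norm mu f by apply: fine_ge0; exact: Lnorm_ge0.
by rewrite -L2norm_sqr ltrXn2r.
Qed.

Lemma L2_sqr_integrable f : measurable_fun setT f ->
  mu.-integrable setT (EFin \o (fun x => f x ^+ 2)) -> L2 mu f.
Proof.
move=> mf /integrableP[_ foo]; rewrite /L2 /= inE; apply/andP; split.
  by rewrite inE.
rewrite inE /= /finite_norm unlock poweR_lty //.
apply: le_lt_trans foo; rewrite le_eqVlt; apply/orP; left; apply/eqP.
apply: eq_integral => x _ /=.
by rewrite powR_mulrn // real_normK ?num_real // ger0_norm // sqr_ge0.
Qed.

Lemma L2_measurable f : L2 mu f -> measurable_fun setT f.
Proof. by rewrite /L2 /= inE => /andP[]; rewrite inE. Qed.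

Lemma integrable_linear a b f g :
  mu.-integrable setT (EFin \o f) -> mu.-integrable setT (EFin \o g) ->
  mu.-integrable setT (EFin \o (fun x => a * f x + b * g x)) /\
  \int[mu]_x (a * f x + b * g x) = a * \int[mu]_x f x + b * \int[mu]_x g x.
Proof.
move=> fi gi.
have iZ c k : mu.-integrable setT (EFin \o k) ->
    mu.-integrable setT (EFin \o (fun x => c * k x)).
  move=> ki; have := integrableZl measurableT c ki.
  by apply: eq_integrable => // x _; rewrite /= EFinM.
split; last by rewrite RintegralD ?iZ // !RintegralZl.
have := integrableD measurableT (iZ a _ fi) (iZ b _ gi).
by apply: eq_integrable => // x _; rewrite /= EFinD.
Qed.

Lemma integrable_linear_sum (I : Type) (s : seq I) (c : I -> R) (F : I -> T -> R) :
  (forall i, mu.-integrable setT (EFin \o F i)) ->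
  mu.-integrable setT (EFin \o (fun x => \sum_(i <- s) c i * F i x)) /\
  \int[mu]_x (\sum_(i <- s) c i * F i x) = \sum_(i <- s) c i * \int[mu]_x F i x.
Proof.
move=> Fi; elim: s => [|i s [IH1 IH2]].
  rewrite big_nil (_ : (fun x => _) = cst 0); last by apply/funext => x; rewrite big_nil.
  by split; [exact: integrable0|rewrite /Rintegral integral0].
have [H1 H2] := integrable_linear (c i) 1 (Fi i) IH1.
rewrite big_cons -IH2 -[X in _ + X]mul1r -H2.
rewrite (_ : (fun x => \sum_(j <- i :: s) _) =
  (fun x => c i * F i x + 1 * (\sum_(j <- s) c j * F j x))) //.
by apply/funext => x; rewrite big_cons mul1r.
Qed.

Lemma dotp_sum_orthogonal {I : eqType} (s : seq I) (e : I -> T -> R)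
    (c : I -> R) v :
    uniq s -> (forall i, L2 mu (e i)) ->
    (forall i j, dotp mu (e i) (e j) = (i == j)%:R * v) ->
  dotp mu (fun x => \sum_(i <- s) c i * e i x) (fun x => \sum_(i <- s) c i * e i x)
  = (\sum_(i <- s) c i ^+ 2) * v.
Proof.
move=> us Le oe; rewrite dotp_suml //; last exact: L2_sum.
rewrite mulr_suml; apply: eq_big_seq => i si.
rewrite dotpC dotp_suml // (bigD1_seq i) //= oe eqxx mul1r big1 ?addr0.
  by rewrite expr2 mulrA.
by move=> j ji; rewrite oe (negbTE ji) mul0r mulr0.
Qed.

(** Expanding the square around the orthogonal projection: this one identity
gives Bessel's inequality, the least-squares property of the coefficients
[dotp f (e i)] and the bias-variance decomposition of a projection
estimator. *)
Lemma dist_span_orthonormal {I : eqType} (s : seq I) (e : I -> T -> R)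
    (c : I -> R) f :
    uniq s -> (forall i, L2 mu (e i)) ->
    (forall i j, dotp mu (e i) (e j) = (i == j)%:R) -> L2 mu f ->
  dotp mu (fun x => \sum_(i <- s) c i * e i x - f x)
          (fun x => \sum_(i <- s) c i * e i x - f x) =
  dotp mu f f - \sum_(i <- s) dotp mu f (e i) ^+ 2
  + \sum_(i <- s) (c i - dotp mu f (e i)) ^+ 2.
Proof.
move=> us Le oe Lf; set g := fun x => \sum_(i <- s) c i * e i x.
have Lg : L2 mu g by exact: L2_sum.
have -> : (fun x => g x - f x) = (fun x => 1 * g x + (-1) * f x).
  by apply/funext => x; rewrite mul1r mulN1r.
have L1 : L2 mu (fun x => 1 * g x + -1 * f x) by exact: L2_linear.
rewrite (dotp_linearl 1 (-1) Lg Lf L1) ![dotp mu _ (fun x => 1 * g x + -1 * f x)]dotpC.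
rewrite (dotp_linearl 1 (-1) Lg Lf Lg) (dotp_linearl 1 (-1) Lg Lf Lf).
have fg : dotp mu g f = \sum_(i <- s) c i * dotp mu f (e i).
  by rewrite dotp_suml //; apply: eq_bigr => i _; rewrite [dotp _ (e i) _]dotpC.
have gg : dotp mu g g = \sum_(i <- s) c i ^+ 2.
  by rewrite (@dotp_sum_orthogonal _ _ _ _ 1) ?mulr1 // => k l; rewrite oe mulr1.
rewrite [dotp mu f g]dotpC fg gg.
have -> : \sum_(i <- s) (c i - dotp mu f (e i)) ^+ 2 =
    \sum_(i <- s) c i ^+ 2 - 2 * \sum_(i <- s) c i * dotp mu f (e i)
    + \sum_(i <- s) dotp mu f (e i) ^+ 2.
  by rewrite mulr_sumr -sumrB -big_split; apply: eq_bigr => i _ /=; ring.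
by ring.
Qed.

End l2.

(** * Moments of Gaussian variables *)

Section whole_line.
Context {R : realType}.
Notation mu := (@lebesgue_measure R).

Lemma cvg_integral_centered (f : R -> R) :
  mu.-integrable [set: R] (EFin \o f) ->
  (\int[mu]_(x in `[(- n.+1%:R)%R, n.+1%:R]) (f x)%:E)%E @[n --> \oo] -->
  (\int[mu]_x (f x)%:E)%E.
Proof.
move=> fi; pose f_ n := (EFin \o f) \_ `[- n.+1%:R, n.+1%:R].
have mf : measurable_fun [set: R] (EFin \o f) := measurable_int _ fi.
have mf_ n : measurable_fun [set: R] (f_ n).
  by apply/(measurable_restrictT _ _).1 => //; exact: measurable_funTS.
have f_f : {ae mu, forall x, [set: R] x -> f_ ^~ x @ \oo --> (EFin \o f) x}.
  apply: nearW => x _; apply: cvg_near_cst; near=> n.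
  rewrite /f_ patchE ifT // inE /= in_itv /= -ler_norml.
  rewrite (@le_trans _ _ n%:R) ?ler_nat //; near: n.
  exact: nbhs_infty_ger.
have f_g : {ae mu, forall x n, [set: R] x -> (`|f_ n x| <= `|(EFin \o f) x|)%E}.
  apply: nearW => x n _; rewrite /f_ patchE; case: ifPn => // _.
  by rewrite abse0 abse_ge0.
have [_ _] := @dominated_convergence _ _ _ mu _ measurableT f_ _ _ mf_ mf f_f (integrable_abse fi) f_g.
by under eq_fun do rewrite -integral_mkcond.
Unshelve. all: by end_near. Qed.

(** Dominated convergence carries the fundamental theorem of calculus from the
segments [[- n, n]] to the line, the boundary terms being asymptotically null. *)
Lemma integral_derivative_vanishing (F f : R -> R) :
  (forall x : R, is_derive x 1 F (f x)) -> continuous f ->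
  mu.-integrable [set: R] (EFin \o f) ->
  F x @[x --> +oo] --> 0 -> F x @[x --> -oo] --> 0 ->
  \int[mu]_x f x = 0.
Proof.
move=> dF cf fi Fy FNy; rewrite /Rintegral.
suff -> : (\int[mu]_x (f x)%:E)%E = 0%E by [].
have := cvg_integral_centered fi.
have cF : continuous F.
  by move=> x; apply: differentiable_continuous; apply/derivable1_diffP; have [] := dF x.
have FTC n : (\int[mu]_(x in `[(- n.+1%:R)%R, n.+1%:R]) (f x)%:E)%E =
    (F n.+1%:R - F (- n.+1%:R))%:E.
  rewrite EFinB; apply: continuous_FTC2.
  - by rewrite gtrN.
  - exact: continuous_subspaceT.
  - split.
    + by move=> x _; have [] := dF x.
    + by apply: cvg_at_right_filter; exact: cF.
    + by apply: cvg_at_left_filter; exact: cF.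
  - by move=> x _; rewrite derive1E; have [] := dF x.
rewrite (funext FTC) => cI; apply: (cvg_unique _ cI) => //.
apply: cvg_EFin; first exact: nearW.
rewrite /comp /= -[X in _ --> X](subr0 0).
apply: cvgB.
- by apply: (cvg_comp _ _ _ Fy); apply/cvgryPge => A; near=> n; near: n;
    move: (nbhs_infty_ger A); apply: filterS => n /le_trans; apply; rewrite ler_nat.
- apply: (cvg_comp _ _ _ FNy); apply/cvgrNyPle => A; near=> n; near: n.
  move: (nbhs_infty_ger (- A)); apply: filterS => n An.
  by rewrite lerNl (le_trans An) // ler_nat.
Unshelve. all: by end_near. Qed.

End whole_line.

Section normal_moments.
Context {R : realType}.
Variables (m s : R).
Hypothesis s0 : s != 0.
Notation mu := (@lebesgue_measure R).
Notation pdf := (normal_pdf m s).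

Lemma is_derive_normal_pdf (x : R) :
  is_derive x 1 pdf (- ((x - m) / s ^+ 2) * pdf x).
Proof.
rewrite normal_pdfE // /normal_fun.
apply: is_derive_eq; rewrite /GRing.scale /=.
by field.
Qed.

(** A density with twice the variance absorbs a fourth power: this bound makes the
moments up to the fourth integrable, and kills the boundary terms when the
density is integrated by parts. *)
Lemma normal_pdf_fourth_moment_le x :
  (x - m) ^+ 4 * pdf x <=
  32 * s ^+ 4 * (normal_peak s / normal_peak (Num.sqrt 2 * s)) *
    normal_pdf m (Num.sqrt 2 * s) x.
Proof.
have t0 : Num.sqrt 2 * s != 0 by rewrite mulf_neq0 // gt_eqF // sqrtr_gt0.
have t2 : (Num.sqrt 2 * s) ^+ 2 = 2 * s ^+ 2 by rewrite exprMn sqr_sqrtr.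
rewrite !normal_pdfE // /normal_fun t2.
have s2 : 0 < s ^+ 2 by rewrite exprn_even_gt0.
set u := (x - m) ^+ 2 / (4 * s ^+ 2).
have u0 : 0 <= u by rewrite divr_ge0 ?sqr_ge0 // mulr_ge0 // ltW.
have -> : - (x - m) ^+ 2 / (s ^+ 2 *+ 2) = - u + - u by rewrite /u; field.
have -> : - (x - m) ^+ 2 / (2 * s ^+ 2 *+ 2) = - u by rewrite /u; field.
have pt : 0 < normal_peak (Num.sqrt 2 * s) by exact: normal_peak_gt0.
have ps : 0 < normal_peak s by exact: normal_peak_gt0.
rewrite [leRHS](_ : _ = 32 * s ^+ 4 * normal_peak s * expR (- u)); last first.
  by field; rewrite gt_eqF.
have -> : (x - m) ^+ 4 = 16 * s ^+ 4 * u ^+ 2 by rewrite /u; field.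
have H : u ^+ 2 * expR (- u) <= 2.
  rewrite expRN ler_pdivrMr ?expR_gt0 //.
  by have := expR_ge1Dxn 1 u0; rewrite (_ : (1.+1)`! = 2)%N //; lra.
rewrite expRD [leLHS](_ : _ =
  16 * s ^+ 4 * normal_peak s * expR (- u) * (u ^+ 2 * expR (- u))); last by ring.
rewrite [leRHS](_ : _ = 16 * s ^+ 4 * normal_peak s * expR (- u) * 2); last by ring.
have s4 : 0 <= s ^+ 4 by rewrite exprn_even_ge0.
by apply: ler_wpM2l => //; rewrite pmulr_lge0 ?expR_gt0 // pmulr_lge0 // mulr_ge0.
Qed.

Let C := 32 * s ^+ 4 * (normal_peak s / normal_peak (Num.sqrt 2 * s)).

Let C_ge0 : 0 <= C.
Proof.
have s4 : 0 <= s ^+ 4 by rewrite exprn_even_ge0.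
apply: mulr_ge0; first exact: mulr_ge0.
by apply: divr_ge0; exact: normal_peak_ge0.
Qed.

Let t0 : Num.sqrt 2 * s != 0.
Proof. by rewrite mulf_neq0 // gt_eqF // sqrtr_gt0. Qed.

Let moment_le k x : (k <= 4)%N ->
  `|(x - m) ^+ k * pdf x| <= pdf x + C * normal_pdf m (Num.sqrt 2 * s) x.
Proof.
move=> k4; rewrite normrM normrX [`|pdf x|]ger0_norm ?normal_pdf_ge0 //.
apply: (@le_trans _ _ (pdf x + (x - m) ^+ 4 * pdf x)); last first.
  by rewrite lerD2l normal_pdf_fourth_moment_le.
rewrite -[X in _ <= X + _]mul1r -mulrDl ler_wpM2r ?normal_pdf_ge0 //.
have -> : (x - m) ^+ 4 = `|x - m| ^+ 4 by rewrite -normrX ger0_norm // exprn_even_ge0.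
have y0 := normr_ge0 (x - m); have [y1|y1] := leP `|x - m| 1.
  by rewrite (@le_trans _ _ 1) ?exprn_ile1 // lerDl exprn_ge0.
by rewrite (@le_trans _ _ (`|x - m| ^+ 4)) ?lerDr // ler_weXn2l // ltW.
Qed.

Let centered_power (k : nat) := fun x : R => (x - m) ^+ k * pdf x.

Let is_derive_moment k (x : R) :
  is_derive x 1 (centered_power k)
    (k%:R * centered_power k.-1 x - (s ^- 2) * centered_power k.+1 x).
Proof.
have D := is_derive_normal_pdf x.
have D1 : is_derive x 1 (fun x : R => x - m) 1 by apply: is_derive_eq; rewrite subr0.
have D2 := is_deriveX k D1; rewrite exprfctE in D2.
have D3 := is_deriveM D2 D.
suff E : k%:R * centered_power k.-1 x - s ^- 2 * centered_power k.+1 x =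
  (x - m) ^+ k *: (- ((x - m) / s ^+ 2) * pdf x) +
    pdf x *: ((k%:R * (x - m) ^+ k.-1) *: 1) by rewrite E; exact: D3.
by rewrite /centered_power /GRing.scale /= [(x - m) ^+ k.+1]exprS; field.
Qed.

Let continuous_moment k : continuous (centered_power k).
Proof.
move=> x; apply: differentiable_continuous; apply/derivable1_diffP.
by have [] := is_derive_moment k x.
Qed.

Lemma integrable_normal_moment k : (k <= 4)%N ->
  mu.-integrable [set: R] (EFin \o (fun x => (x - m) ^+ k * pdf x)).
Proof.
move=> k4.
apply: (@le_integrable _ _ _ mu _ measurableT _
  (fun x => (pdf x)%:E + C%:E * (normal_pdf m (Num.sqrt 2 * s) x)%:E)%E).
- apply/measurable_EFinP; apply: continuous_measurable_fun; exact: continuous_moment.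
- move=> x _; rewrite -EFinM -EFinD /= lee_fin.
  by rewrite (le_trans (moment_le x k4)) // ler_norm.
- apply: integrableD => //; first exact: integrable_normal_pdf.
  by apply: integrableZl => //; exact: integrable_normal_pdf.
Qed.

Let K := normal_peak s + C * normal_peak (Num.sqrt 2 * s).

Let moment_decay k x e : (k <= 3)%N -> 0 < e -> K / e < `|x - m| ->
  `|centered_power k x| < e.
Proof.
move=> k3 e0; rewrite ltr_pdivrMr // => Kx.
have y0 : 0 < `|x - m|.
  rewrite lt_neqAle normr_ge0 andbT; apply/eqP => y0.
  move: Kx; rewrite -y0 mul0r ltNge /K addr_ge0 ?normal_peak_ge0 //.
  by rewrite mulr_ge0 // normal_peak_ge0.
rewrite -(ltr_pM2l y0) (le_lt_trans _ Kx) //.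
rewrite -normrM /centered_power mulrA -exprS (le_trans (moment_le x _)) //.
by rewrite lerD ?normal_pdf_ub // ler_wpM2l // normal_pdf_ub.
Qed.

(** Integration by parts: the derivative of [(x - m) ^+ k * pdf x] has null
integral. *)
Lemma normal_moment_rec k : (k <= 3)%N ->
  \int[mu]_x ((x - m) ^+ k.+1 * pdf x) =
  s ^+ 2 * k%:R * \int[mu]_x ((x - m) ^+ k.-1 * pdf x).
Proof.
move=> k3.
have i1 : mu.-integrable [set: R] (EFin \o centered_power k.-1).
  by apply: integrable_normal_moment; case: k k3 => // k; rewrite /= => /ltnW/leqW.
have i2 : mu.-integrable [set: R] (EFin \o centered_power k.+1).
  exact: integrable_normal_moment.
have iZ c f : mu.-integrable [set: R] (EFin \o f) ->
    mu.-integrable [set: R] (EFin \o (fun x => c * f x)).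
  move=> fi; have := integrableZl measurableT c fi.
  by apply: eq_integrable => // x _; rewrite /= EFinM.
have : \int[mu]_x (k%:R * centered_power k.-1 x - s ^- 2 * centered_power k.+1 x) = 0.
  apply: (integral_derivative_vanishing (is_derive_moment k)).
  - move=> x; apply: cvgB; apply: cvgM; try exact: cvg_cst; exact: continuous_moment.
  - have := integrableB measurableT (iZ k%:R _ i1) (iZ (s ^- 2) _ i2).
    by apply: eq_integrable.
  - apply/cvgrPdist_lt => e e0; near=> x; rewrite sub0r normrN.
    apply: moment_decay => //; rewrite (@lt_le_trans _ _ (x - m)) ?ler_norm //.
    rewrite ltrBrDr; near: x; exact: nbhs_pinfty_gt (num_real _).
  - apply/cvgrPdist_lt => e e0; near=> x; rewrite sub0r normrN.
    apply: moment_decay => //; rewrite -normrN (@lt_le_trans _ _ (- (x - m))) ?ler_norm //.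
    rewrite ltrNr ltrBlDr; near: x; exact: nbhs_ninfty_lt (num_real _).
rewrite RintegralB //; [|exact: iZ..]; rewrite !RintegralZl // => /eqP.
rewrite subr_eq0 => /eqP E.
transitivity (s ^+ 2 * (s ^- 2 * \int[mu]_x centered_power k.+1 x)).
  by rewrite mulVKf // sqrf_eq0.
by rewrite -E mulrA.
Unshelve. all: by end_near. Qed.

Lemma normal_moment0 : \int[mu]_x ((x - m) ^+ 0 * pdf x) = 1.
Proof.
rewrite (@eq_Rintegral _ _ _ mu _ pdf); last by move=> x _; rewrite expr0 mul1r.
by rewrite /Rintegral integral_normal_pdf.
Qed.

Lemma normal_moment1 : \int[mu]_x ((x - m) ^+ 1 * pdf x) = 0.
Proof. by rewrite normal_moment_rec // mulr0 mul0r. Qed.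

Lemma normal_moment2 : \int[mu]_x ((x - m) ^+ 2 * pdf x) = s ^+ 2.
Proof. by rewrite normal_moment_rec // normal_moment0 !mulr1. Qed.

Lemma normal_moment4 : \int[mu]_x ((x - m) ^+ 4 * pdf x) = 3 * s ^+ 4.
Proof. by rewrite normal_moment_rec //= normal_moment2; ring. Qed.

(** The density [pdf] is a Radon-Nikodym derivative, by uniqueness of the latter. *)
Lemma ge0_integral_normal_law {d} {T : measurableType d} (P : probability T R)
    (X : T -> R) (f : R -> R) :
    measurable_fun [set: T] X ->
    (forall A : set (measurableTypeR R), measurable A ->
       P (X @^-1` A) = normal_prob m s A) ->
    measurable_fun [set: R] f -> (forall x, 0 <= f x) ->
  (\int[P]_w (f (X w))%:E = \int[mu]_x (f x * pdf x)%:E)%E.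
Proof.
move=> mX PX mf f0.
transitivity (\int[pushforward P (X : T -> measurableTypeR R)]_y (f y)%:E)%E.
  rewrite ge0_integral_pushforward //; first exact/measurable_EFinP.
  by move=> y _; rewrite lee_fin.
transitivity (\int[normal_prob m s]_y (f y)%:E)%E.
  by apply: eq_measure_integral => A mA _; exact: PX.
rewrite -(Radon_Nikodym_SigmaFinite.change_of_variables (normal_prob_dominates m s)) //.
- apply: ae_eq_integral => //.
  + apply: emeasurable_funM; first exact/measurable_EFinP.
    apply: (measurable_int mu); apply: Radon_Nikodym_SigmaFinite.f_integrable.
    exact: normal_prob_dominates.
  + apply/measurable_EFinP; apply: measurable_funM => //; exact: measurable_normal_pdf.
  + under [X in ae_eq _ _ _ X]eq_fun do rewrite EFinM.
    apply: ae_eqe_mul2l; apply: integral_ae_eq => //.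
    * apply: Radon_Nikodym_SigmaFinite.f_integrable; exact: normal_prob_dominates.
    * apply/measurable_EFinP; exact: measurable_normal_pdf.
    * move=> A _ mA; rewrite -Radon_Nikodym_SigmaFinite.f_integral //.
      exact: normal_prob_dominates.
- exact/measurable_EFinP.
Qed.

End normal_moments.

Lemma integrable_normal_law {d} {T : measurableType d} {R : realType}
    (P : probability T R) (X : T -> R) (m s : R) (f : R -> R) :
    s != 0 -> measurable_fun [set: T] X ->
    (forall A : set (measurableTypeR R), measurable A ->
       P (X @^-1` A) = normal_prob m s A) ->
    measurable_fun [set: R] f -> (forall x, 0 <= f x) ->
    (@lebesgue_measure R).-integrable [set: R]
      (EFin \o (fun x => f x * normal_pdf m s x)) ->
  P.-integrable setT (EFin \o (fun w => f (X w))) /\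
  \int[P]_w f (X w) = \int[@lebesgue_measure R]_x (f x * normal_pdf m s x).
Proof.
move=> s0 mX PX mf f0 fi.
have E := ge0_integral_normal_law mX PX mf f0.
split; last by rewrite /Rintegral E.
apply/integrableP; split.
  by apply/measurable_EFinP; exact: measurableT_comp.
under eq_integral do rewrite /= ger0_norm //.
rewrite E; have /integrableP[_] := fi.
by under eq_integral do rewrite /= ger0_norm ?mulr_ge0 ?normal_pdf_ge0 //.
Qed.

Section gaussian_moments.
Context {d} {T : measurableType d} {R : realType}.
Variable P : probability T R.
Implicit Types X : T -> R.

Lemma L2_cst (c : R) : L2 P (cst c).
Proof. exact: (Lfun_cst P c 2). Qed.

Lemma L2_integrable X : L2 P X -> P.-integrable setT (EFin \o X).
Proof.
move=> LX; have := L2_mul_integrable LX (L2_cst 1).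
by apply: eq_integrable => // w _; rewrite /= mulr1.
Qed.

Lemma Rintegral_cst_prob (c : R) : \int[P]_w c = c.
Proof.
rewrite /Rintegral integral_cst //; transitivity (fine (c%:E * 1)%E).
  by congr (fine (_ * _)%E); exact: probability_setT.
by rewrite mule1.
Qed.

Lemma normal_law_mean X m s : s != 0 -> L2 P X ->
  (forall A : set (measurableTypeR R), measurable A ->
       P (X @^-1` A) = normal_prob m s A) ->
  \int[P]_w X w = m.
Proof.
move=> s0 LX PX; have mX := L2_measurable LX.
pose mom k x := (x - m) ^+ k * normal_pdf m s x.
have im k : (k <= 4)%N -> (@lebesgue_measure R).-integrable [set: R] (EFin \o mom k).
  exact: integrable_normal_moment.
have mpol k : measurable_fun [set: R] (fun x : R => (x - m) ^+ k).
  by apply: measurable_funX; exact: measurable_funB.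
(* the passage from the law to the density concerns nonnegative functions, and
   [x - m] is a difference of two nonnegative polynomials *)
pose g2 x := (x - m) ^+ 2 + 1; pose g1 x := g2 x + (x - m) ^+ 1.
have mg2 : measurable_fun [set: R] g2 by exact: measurable_funD.
have mg1 : measurable_fun [set: R] g1 by exact: measurable_funD.
have g20 x : 0 <= g2 x by rewrite addr_ge0 // sqr_ge0.
have g10 x : 0 <= g1 x.
  rewrite /g1 /g2 expr1; have := sqr_ge0 (x - m + 2^-1).
  by rewrite sqrrD; lra.
have [i2 e2] := integrable_linear 1 1 (im 2 isT) (im 0 isT).
have [i1 e1] := integrable_linear 1 1 i2 (im 1 isT).
have eg2 x : g2 x * normal_pdf m s x = 1 * mom 2%N x + 1 * mom 0%N x.
  by rewrite /g2 /mom expr0; ring.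
have eg1 x : g1 x * normal_pdf m s x = 1 * (1 * mom 2%N x + 1 * mom 0%N x) + 1 * mom 1%N x.
  by rewrite /g1 mulrDl eg2 /mom; ring.
have [] := integrable_normal_law s0 mX PX mg2 g20 _.
  by apply: eq_integrable i2 => // x _; rewrite /= eg2.
have [] := integrable_normal_law s0 mX PX mg1 g10 _.
  by apply: eq_integrable i1 => // x _; rewrite /= eg1.
rewrite (funext eg1) (funext eg2) e1 e2 normal_moment1 // => I1 E1 I2 E2.
have [_] := integrable_linear 1 (-1) I1 I2.
rewrite E1 E2 (_ : (fun w => _) = (fun w => 1 * X w + (-1) * (cst m w))); last first.
  by apply/funext => w; rewrite /g1 /=; ring.
have [_ ->] := integrable_linear 1 (-1) (L2_integrable LX) (L2_integrable (L2_cst m)).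
rewrite Rintegral_cst_prob; lra.
Qed.

(** Both sides vanish for a variable that is almost surely constant, since its
mean is null; otherwise the identity is the one between the moments of the
normal law. *)
Lemma centered_gaussian_fourth_moment X :
  L2 P X -> gaussian_variable P X -> \int[P]_w X w = 0 ->
  L2 P (fun w => X w ^+ 2) /\
  \int[P]_w (X w ^+ 4) = 3 * (\int[P]_w (X w ^+ 2)) ^+ 2.
Proof.
move=> LX gX X0; have mX := L2_measurable LX.
have mX2 : measurable_fun setT (fun w => X w ^+ 2) by exact: measurable_funX.
case: gX => [[c Xc]|[m [s [s0 PX]]]].
  have E k : (0 < k)%N -> {ae P, forall w, setT w -> (X w ^+ k)%:E = 0%E}.
    move=> k0.
    have c0 : c = 0.
      rewrite -X0 -[LHS]Rintegral_cst_prob; congr fine.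
      apply: ae_eq_integral => //; first exact/measurable_EFinP.
      by apply: filterS Xc => w -> _.
    by apply: filterS Xc => w -> _; rewrite c0 expr0n gtn_eqF.
  have I k : (0 < k)%N -> P.-integrable setT (EFin \o (fun w => X w ^+ k)).
    move=> k0; apply/integrableP; split.
      by apply/measurable_EFinP; exact: measurable_funX.
    rewrite (ae_eq_integral (cst 0%E)) ?integral0 ?ltry //.
      by apply: measurableT_comp => //; apply/measurable_EFinP; exact: measurable_funX.
    by apply: filterS (E _ k0) => w H /H [Xw]; rewrite /= Xw normr0.
  split.
    apply: L2_sqr_integrable => //.
    by apply: eq_integrable (I 4%N isT) => // w _; rewrite /= -exprM.
  rewrite /Rintegral (ae_eq_integral (cst 0%E)) ?integral0 //=; last 2 first.
    by apply/measurable_EFinP; exact: measurable_funX.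
    exact: E.
  rewrite (ae_eq_integral (cst 0%E)) ?integral0 //=; last 2 first.
    by apply/measurable_EFinP; exact: measurable_funX.
    exact: E.
  by rewrite expr0n mulr0.
have m0 : m = 0 by rewrite -X0 (normal_law_mean s0 LX PX).
rewrite m0 in PX.
have F k : (k <= 2)%N -> P.-integrable setT (EFin \o (fun w => X w ^+ k.*2)) /\
    \int[P]_w X w ^+ k.*2 =
    \int[@lebesgue_measure R]_x ((x - 0) ^+ k.*2 * normal_pdf 0 s x).
  move=> k2; rewrite (@eq_Rintegral _ _ _ (@lebesgue_measure R) _ (fun x => x ^+ k.*2 * normal_pdf 0 s x)); last first.
    by move=> x _; rewrite subr0.
  apply: (integrable_normal_law s0 mX PX).
  - exact: measurable_funX.
  - by move=> x; rewrite exprn_even_ge0 // odd_double.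
  - have k4 : (k.*2 <= 4)%N by rewrite -(leq_double k 2) in k2.
    by have := integrable_normal_moment 0 s0 k4; apply: eq_integrable => // x _; rewrite /= subr0.
split.
  apply: L2_sqr_integrable => //.
  by apply: eq_integrable (F 2%N isT).1 => // w _; rewrite /= -exprM.
rewrite (F 2%N isT).2 (F 1%N isT).2 normal_moment4 // normal_moment2 //.
by rewrite -exprM.
Qed.

End gaussian_moments.

(** * Energy of a family of white noise coefficients *)

Section gaussian_white_family.
Context {d} {T : measurableType d} {R : realType}.
Variables (P : probability T R) (I : eqType) (eps : I -> T -> R).
Hypothesis eps_L2 : forall i, L2 P (eps i).
Hypothesis eps_mean : forall i, \int[P]_w eps i w = 0.
Hypothesis eps_cov : forall i j, dotp P (eps i) (eps j) = (i == j)%:R.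
Hypothesis eps_gaussian : forall i j (a b : R),
  gaussian_variable P (fun w => a * eps i w + b * eps j w).

Let pair_moments i j a b : L2 P (fun w => (a * eps i w + b * eps j w) ^+ 2) /\
  \int[P]_w ((a * eps i w + b * eps j w) ^+ 4) =
  3 * (a ^+ 2 + b ^+ 2 + 2 * a * b * (i == j)%:R) ^+ 2.
Proof.
have LX : L2 P (fun w => a * eps i w + b * eps j w) by exact: L2_linear.
have [|L4 ->] := centered_gaussian_fourth_moment LX (eps_gaussian i j a b).
  have [_ ->] := integrable_linear a b (L2_integrable (eps_L2 i)) (L2_integrable (eps_L2 j)).
  by rewrite !eps_mean; ring.
split => //; congr (3 * _ ^+ 2).
transitivity (dotp P (fun w => a * eps i w + b * eps j w) (fun w => a * eps i w + b * eps j w)).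
  by congr fine; apply: eq_integral => w _; rewrite expr2.
rewrite dotp_linearl // ![dotp P _ (fun w => a * eps i w + _)]dotpC !dotp_linearl //.
by rewrite !eps_cov !eqxx [j == i]eq_sym; case: (i == j) => /=; ring.
Qed.

Let sqr_L2 i : L2 P (fun w => eps i w ^+ 2).
Proof.
have [H _] := pair_moments i i 1 0.
by congr (L2 P _): H; apply/funext => w; rewrite mul1r mul0r addr0.
Qed.

Let sqr_mean i : \int[P]_w (eps i w ^+ 2) = 1.
Proof.
transitivity (dotp P (eps i) (eps i)); last by rewrite eps_cov eqxx.
by congr fine; apply: eq_integral => w _; rewrite expr2.
Qed.

(** The fourth moments of [eps i], [eps j], [eps i + eps j] and [eps i - eps j]
determine the mixed moment of [eps i ^+ 2] and [eps j ^+ 2], so that the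
squares are uncorrelated without any appeal to independence. *)
Let sqr_cov i j : dotp P (fun w => eps i w ^+ 2) (fun w => eps j w ^+ 2) =
  1 + (i == j)%:R * 2.
Proof.
have [->|ij] := eqVneq i j.
  have [_] := pair_moments j j 1 0; rewrite eqxx => H.
  transitivity (\int[P]_w (1 * eps j w + 0 * eps j w) ^+ 4).
    by congr fine; apply: eq_integral => w _; congr EFin; ring.
  by rewrite H ?eqxx /=; ring.
have F a b := (pair_moments i j a b).2; rewrite (negbTE ij) in F.
have FI a b : P.-integrable setT (EFin \o (fun w => (a * eps i w + b * eps j w) ^+ 4)).
  have := L2_mul_integrable (pair_moments i j a b).1 (pair_moments i j a b).1.
  by apply: eq_integrable => // w _; rewrite /= -exprD.
have [I1 E1] := integrable_linear 12^-1 12^-1 (FI 1 1) (FI 1 (-1)).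
have [I2 E2] := integrable_linear (- 6^-1) (- 6^-1) (FI 1 0) (FI 0 1).
have [_ E] := integrable_linear 1 1 I1 I2.
transitivity (\int[P]_w
   (1 * (12^-1 * (1 * eps i w + 1 * eps j w) ^+ 4 + 12^-1 * (1 * eps i w + -1 * eps j w) ^+ 4) +
    1 * (- 6^-1 * (1 * eps i w + 0 * eps j w) ^+ 4 + - 6^-1 * (0 * eps i w + 1 * eps j w) ^+ 4))).
  by congr fine; apply: eq_integral => w _; congr EFin; field.
by rewrite E E1 E2 !F /=; field.
Qed.

Lemma chi_square_mean (s : seq I) :
  P.-integrable setT (EFin \o (fun w => \sum_(i <- s) eps i w ^+ 2)) /\
  \int[P]_w (\sum_(i <- s) eps i w ^+ 2) = (size s)%:R.
Proof.
have [H1 H2] := integrable_linear_sum s (fun=> 1) (fun i => L2_integrable (sqr_L2 i)).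
have -> : (fun w => \sum_(i <- s) eps i w ^+ 2) = fun w => \sum_(i <- s) 1 * eps i w ^+ 2.
  by apply/funext => w; apply: eq_bigr => i _; rewrite mul1r.
split=> //; rewrite H2; under eq_bigr do rewrite sqr_mean mulr1.
by rewrite big_const_seq count_predT iter_addr_0.
Qed.

(** The variables [eps i ^+ 2 - 1] are orthogonal, of squared norm [2]. *)
Lemma chi_square_variance (s : seq I) : uniq s ->
  P.-integrable setT (EFin \o (fun w => (\sum_(i <- s) eps i w ^+ 2 - (size s)%:R) ^+ 2)) /\
  \int[P]_w ((\sum_(i <- s) eps i w ^+ 2 - (size s)%:R) ^+ 2) = 2 * (size s)%:R.
Proof.
move=> us.
pose eta i w := 1 * eps i w ^+ 2 + (-1) * cst 1 w.
have Leta i : L2 P (eta i) by apply: L2_linear => //; exact: L2_cst.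
have c1 : dotp P (cst 1) (cst 1) = 1.
  by rewrite -[RHS](Rintegral_cst_prob P 1); congr fine; apply: eq_integral => w _; rewrite mulr1.
have e1 i : dotp P (fun w => eps i w ^+ 2) (cst 1) = 1.
  by rewrite -[RHS](sqr_mean i); congr fine; apply: eq_integral => w _; rewrite mulr1.
have eta_cov i j : dotp P (eta i) (eta j) = (i == j)%:R * 2.
  rewrite /eta dotp_linearl //; last 2 first.
    exact: L2_cst.
    exact: Leta.
  rewrite ![dotp P _ (fun w => 1 * eps j w ^+ 2 + _)]dotpC.
  rewrite !dotp_linearl //; try exact: L2_cst.
  by rewrite [dotp P (cst 1) (fun w => eps i w ^+ 2)]dotpC !sqr_cov !e1 c1 eq_sym; case: (i == j) => /=; ring.
have E w : (\sum_(i <- s) eps i w ^+ 2 - (size s)%:R) ^+ 2 =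
    (\sum_(i <- s) 1 * eta i w) * (\sum_(i <- s) 1 * eta i w).
  rewrite -expr2; congr (_ ^+ 2); under [RHS]eq_bigr do rewrite mul1r /eta mul1r /= mulr1.
  by rewrite sumrB big_const_seq count_predT iter_addr_0.
rewrite (funext E); split.
  by apply: L2_mul_integrable; exact: L2_sum.
have := dotp_sum_orthogonal (fun=> 1) us Leta eta_cov; rewrite /dotp => ->.
by rewrite big_const_seq count_predT iter_addr_0 expr1n mulrC.
Qed.

End gaussian_white_family.

(** An integrable variable of mean less than [1] is somewhere less than [1]:
this turns bounds in mean into the choice of one good outcome. *)
Lemma exists_lt1_of_mean_lt1 {d} {T : measurableType d} {R : realType}
    (P : probability T R) (Z : T -> R) :
  P.-integrable setT (EFin \o Z) -> \int[P]_w Z w < 1 -> exists w, Z w < 1.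
Proof.
move=> Zi Z1; apply: contrapT => /forallNP H.
suff: 1 <= \int[P]_w Z w by rewrite leNgt Z1.
rewrite -(Rintegral_cst_prob P 1); apply: le_Rintegral => //.
  exact: (L2_integrable (L2_cst P 1)).
by move=> w _; rewrite leNgt; apply/negP; exact: H.
Qed.

(** * Models spanned by wavelets *)

Section finite_families.
Context {d : measure_display} {T : measurableType d} {R : realType}.
Variable mu : {measure set T -> \bar R}.

Lemma span_sum (I : eqType) (e : I -> T -> R) (s : seq I) (S : set (T -> R))
    (c : I -> R) : (forall i, i \in s -> S (e i)) ->
  span S (fun x => \sum_(i <- s) c i * e i x).
Proof.
move=> Se; exists (size s), (fun k => c (tnth (in_tuple s) k)),
  (fun k => e (tnth (in_tuple s) k)); split.
  by move=> k; apply: Se; exact: mem_tnth.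
by apply/funext => x; rewrite big_tnth.
Qed.

(** A combination may use the same generator several times; adding up the
coefficients of each generator gives one coefficient per element of [s]. *)
Lemma span_familyP (I : eqType) (e : I -> T -> R) (s : seq I) (f : T -> R) :
  uniq s ->
  span (e @` [set i | i \in s]) f <->
  exists c : I -> R, f = fun x => \sum_(i <- s) c i * e i x.
Proof.
move=> us; split; last first.
  by move=> [c ->]; apply: span_sum => i si; exists i.
move=> [n [c [g [Hg ->]]]].
have /choice [i_ Hi] : forall k, exists i, i \in s /\ e i = g k.
  by move=> k; have [i si <-] := Hg k; exists i.
exists (fun i => \sum_(k < n | i_ k == i) c k); apply/funext => x.
under [RHS]eq_bigr do rewrite mulr_suml.
under [RHS]eq_bigr do rewrite big_mkcond.
rewrite exchange_big /=; apply: eq_bigr => k _.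
have [si gk] := Hi k.
rewrite (bigD1_seq (i_ k)) //= eqxx gk big1 ?addr0 //.
by move=> i /negbTE ik; rewrite eq_sym ik.
Qed.

Lemma span_rangeP (n : nat) (e : 'I_n -> T -> R) (f : T -> R) :
  span (range e) f <-> exists c : 'I_n -> R, f = fun x => \sum_(i < n) c i * e i x.
Proof.
have <- : e @` [set i | i \in index_enum 'I_n] = range e.
  by congr image; apply/seteqP; split => // i _; rewrite /= mem_index_enum.
by apply: span_familyP; rewrite index_enum_uniq.
Qed.

(** The matrices that express each family in the other have product [1], the
family [e] being free. *)
Lemma free_family_size_le (n m : nat) (e : 'I_n -> T -> R) (g : 'I_m -> T -> R) :
  free_family mu e -> span (range e) = span (range g) -> (n <= m)%N.
Proof.
move=> fe eg.
have in_span k (h : 'I_k -> T -> R) i : span (range h) (h i).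
  apply/span_rangeP; exists (fun j => (j == i)%:R); apply/funext => x.
  by rewrite (bigD1 i) //= eqxx mul1r big1 ?addr0 // => j /negbTE ->; rewrite mul0r.
have /choice [A HA] : forall i, exists c : 'I_m -> R, e i = fun x => \sum_(j < m) c j * g j x.
  by move=> i; apply/span_rangeP; rewrite -eg; exact: in_span.
have /choice [B HB] : forall j, exists c : 'I_n -> R, g j = fun x => \sum_(i < n) c i * e i x.
  by move=> j; apply/span_rangeP; rewrite eg; exact: in_span.
apply: (@mulmx1_min _ _ _ (\matrix_(i < n, j < m) A i j) (\matrix_(j < m, i < n) B j i)).
apply/matrixP => i k; rewrite !mxE.
apply/eqP; rewrite -subr_eq0; apply/eqP; move: k.
apply: fe; apply: nearW => x.
under eq_bigr do rewrite mulrBl; rewrite sumrB.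
rewrite [X in _ - X](bigD1 i) //= eqxx mul1r [X in _ - (_ + X)]big1 ?addr0; last first.
  by move=> k /negbTE ki; rewrite eq_sym ki mul0r.
apply/eqP; rewrite subr_eq0; apply/eqP; rewrite [in RHS]HA.
under [LHS]eq_bigr do rewrite mulr_suml.
rewrite exchange_big /=; apply: eq_bigr => j _; rewrite HB mulr_sumr.
by apply: eq_bigr => k _; rewrite !mxE mulrA.
Qed.

Lemma dimension_orthonormal (I : eqType) (e : I -> T -> R) (s : seq I) :
    uniq s -> (forall i, L2 mu (e i)) ->
    (forall i j, dotp mu (e i) (e j) = (i == j)%:R) ->
  dimension mu (span (e @` [set i | i \in s])) = size s.
Proof.
move=> us Le oe; set V := span _.
pose g (k : 'I_(size s)) := e (tnth (in_tuple s) k).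
have tI : injective (tnth (in_tuple s)) by apply/tuple_uniqP.
have fg : free_family mu g.
  move=> c c0 k.
  have : dotp mu (fun x => \sum_(i < size s) c i * g i x) (g k) = c k.
    rewrite dotp_suml; [|by move=> i; exact: Le|exact: Le].
    rewrite (bigD1 k) //= oe eqxx mulr1 big1 ?addr0 // => i ik.
    by rewrite oe (inj_eq tI) (negbTE ik) mulr0.
  move=> <-; rewrite /dotp /Rintegral (ae_eq_integral (cst 0%E)) ?integral0 //.
    apply/measurable_EFinP; apply: measurable_funM; last exact: (L2_measurable (Le _)).
    by apply: L2_measurable; apply: L2_sum => i; exact: Le.
  by apply: filterS c0 => x /= H _; rewrite H mul0r.
have Vg : V = span (range g).
  congr span; apply/seteqP; split => [_ [i si <-]|_ [k _ <-]].
    have ilt : (index i s < size s)%N by rewrite index_mem.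
    exists (Ordinal ilt) => //; rewrite /g (tnth_nth i) /= nth_index //.
  by exists (tnth (in_tuple s) k) => //=; exact: mem_tnth.
apply: xget_unique; first by exists g.
move=> n [h [fh Vh]]; apply/eqP; rewrite eqn_leq.
rewrite (free_family_size_le fh (_ : _ = span (range g))) -?Vh //.
by rewrite (free_family_size_le fg (_ : _ = span (range h))) // -Vg -Vh.
Qed.

End finite_families.

Section wavelet_indices.

Definition level (j : nat) : seq windex :=
  [seq Some (Tagged (fun j => 'I_(2 ^ j)) k) | k <- enum 'I_(2 ^ j)].

Definition indices (N : nat) : seq windex :=
  (None : windex) :: flatten [seq level j | j <- iota 0 N].

Lemma indicesS N : indices N.+1 = indices N ++ level N.
Proof.
have iotaS : iota 0 N.+1 = iota 0 N ++ [:: N] by rewrite -(addn1 N) iotaD.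
by rewrite /indices iotaS map_cat flatten_cat /= cats0.
Qed.

Lemma size_level j : size (level j) = (2 ^ j)%N.
Proof. by rewrite size_map size_enum_ord. Qed.

Lemma size_indices N : size (indices N) = (2 ^ N)%N.
Proof.
elim: N => // N IH.
by rewrite indicesS size_cat IH size_level expnS mul2n addnn.
Qed.

Lemma mem_level j i : i \in level j -> exists k : 'I_(2 ^ j),
  i = Some (Tagged (fun j => 'I_(2 ^ j)) k).
Proof. by move=> /mapP[k _ ->]; exists k. Qed.

Lemma mem_indices N i : i \in indices N <-> below N i.
Proof.
case: i => [[j k]|]; last by rewrite /below inE.
rewrite /below /= inE /=; split.
  move=> /flattenP[l /mapP[j']]; rewrite mem_iota add0n /= => jN -> /mem_level[k'].
  by move=> /(congr1 (fun i : windex => if i is Some jk then tag jk else 0%N)) /= ->.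
move=> jN; apply/flattenP; exists (level j); first by apply: map_f; rewrite mem_iota.
by apply/mapP; exists k => //; rewrite mem_enum.
Qed.

Lemma uniq_level j : uniq (level j).
Proof.
rewrite map_inj_uniq ?enum_uniq // => k l [] E.
by have := eq_from_Tagged E.
Qed.

Lemma uniq_indices N : uniq (indices N).
Proof.
elim: N => // N IH; rewrite indicesS cat_uniq IH uniq_level andbT /=.
apply/hasPn => i /mem_level[k ->]; apply/negP => /mem_indices.
by rewrite /below /= ltnn.
Qed.

Lemma below_seteq N : [set i | below N i] = [set i | i \in indices N].
Proof. by apply/seteqP; split => i /= /mem_indices. Qed.

End wavelet_indices.

Section wavelet_models.
Context {R : realType}.
Variables phi psi : R -> R.
Hypothesis onb : orthonormal_basis leb01 (L2 leb01) (wave phi psi).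
Notation wave := (wave phi psi).

Let wave_L2 i : L2 leb01 (wave i).
Proof. by case: onb. Qed.

Let wave_on i j : dotp leb01 (wave i) (wave j) = (i == j)%:R.
Proof. by case: onb. Qed.

Lemma modelP N f : model phi psi N f <->
  exists c : windex -> R, f = fun x => \sum_(i <- indices N) c i * wave i x.
Proof. by rewrite /model below_seteq; apply: span_familyP; exact: uniq_indices. Qed.

Lemma model_dimE N : model_dim phi psi N = (2 ^ N)%N.
Proof.
rewrite /model_dim /model below_seteq dimension_orthonormal ?size_indices //.
exact: uniq_indices.
Qed.

Lemma linear_on_span_sum (y : (R -> R) -> R) (s : seq windex) (c : windex -> R) :
  linear_on_span (range wave) y ->
  y (fun x => \sum_(i <- s) c i * wave i x) = \sum_(i <- s) c i * y (wave i).
Proof.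
move=> ly.
have sp t : span (range wave) (fun x => \sum_(i <- t) c i * wave i x).
  by apply: span_sum => i _; exists i.
have sp1 i : span (range wave) (wave i).
  have := @span_sum _ _ R _ wave [:: i] (range wave) (fun=> 1).
  rewrite (_ : (fun x => _) = wave i); last by apply/funext => x; rewrite big_seq1 mul1r.
  by apply=> j _; exists j.
elim: s => [|i s IH].
  (* [y] vanishes on the empty sum, seen as a combination with null weights *)
  transitivity (y (fun x => 0 * wave None x + 0 * wave None x)).
    by congr y; apply/funext => x; rewrite big_nil !mul0r addr0.
  by rewrite ly // big_nil !mul0r addr0.
rewrite big_cons -IH -[X in _ + X]mul1r -ly //.
by congr y; apply/funext => x; rewrite big_cons mul1r.
Qed.

Section estimator.
Variable y : (R -> R) -> R.
Hypothesis y_linear : linear_on_span (range wave) y.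

Let contrastE N (c : windex -> R) :
  contrast y (fun x => \sum_(i <- indices N) c i * wave i x) =
  \sum_(i <- indices N) (c i - y (wave i)) ^+ 2 - \sum_(i <- indices N) y (wave i) ^+ 2.
Proof.
rewrite /contrast L2norm_sqr linear_on_span_sum //.
rewrite (@dotp_sum_orthogonal _ _ _ _ _ _ _ _ 1) ?mulr1 ?uniq_indices //; last first.
  by move=> i j; rewrite mulr1.
rewrite mulr_sumr -sumrB -big_split /=; apply: eq_bigr => i _; ring.
Qed.

(** Minimising the contrast over a model amounts to minimising
[\sum_i (c_i - y_i) ^+ 2], whence the minimiser keeps the observed
coefficients. *)
Lemma model_estimatorE N : model_estimator phi psi N y =
  fun x => \sum_(i <- indices N) y (wave i) * wave i x.
Proof.
have My : model phi psi N (fun x => \sum_(i <- indices N) y (wave i) * wave i x).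
  by apply/modelP; exists (fun i => y (wave i)).
apply: xget_unique; first split => //.
  move=> _ /modelP[c ->]; rewrite !contrastE lerD2r big1_seq.
    by apply: sumr_ge0 => i _; rewrite sqr_ge0.
  by move=> i _; rewrite subrr expr0n.
move=> _ [/modelP[c ->]] /(_ _ My).
rewrite !contrastE lerD2r [leRHS]big1_seq; last by move=> i _; rewrite subrr expr0n.
move=> cy; apply/funext => x; apply: eq_big_seq => i iN; congr (_ * _).
have : \sum_(i <- indices N) (c i - y (wave i)) ^+ 2 == 0.
  by rewrite eq_le cy /= sumr_ge0 // => j _; rewrite sqr_ge0.
rewrite psumr_eq0 => [/allP /(_ i iN) /=|j _]; last by rewrite sqr_ge0.
by rewrite sqrf_eq0 subr_eq0 => /eqP.
Qed.

Lemma penalizedE (lambda : nat -> R) n N : penalized phi psi lambda n y N =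
  - \sum_(i <- indices N) y (wave i) ^+ 2 + lambda n / n%:R * (2 ^ N)%:R.
Proof.
rewrite /penalized model_estimatorE contrastE model_dimE big1_seq ?sub0r //.
by move=> i _; rewrite subrr expr0n.
Qed.

End estimator.

Section bias.
Variable s : R -> R.
Hypothesis s_L2 : L2 leb01 s.
Notation theta i := (dotp leb01 s (wave i)).

(** By Pythagoras' theorem, the squared distance of [s] to the model of level
[N]. *)
Definition bias (N : nat) : R :=
  dotp leb01 s s - \sum_(i <- indices N) theta i ^+ 2.

Lemma dist_model N (c : windex -> R) :
  L2norm leb01 ((fun x => \sum_(i <- indices N) c i * wave i x) \- s) ^+ 2 =
  bias N + \sum_(i <- indices N) (c i - theta i) ^+ 2.
Proof. by rewrite L2norm_sqr dist_span_orthonormal ?uniq_indices. Qed.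

Lemma bias_ge0 N : 0 <= bias N.
Proof.
have := dist_model N (fun i => theta i).
by rewrite big1_seq ?addr0 => [<-|i _]; rewrite ?sqr_ge0 // subrr expr0n.
Qed.

Lemma biasS N : bias N = bias N.+1 + \sum_(i <- level N) theta i ^+ 2.
Proof. by rewrite /bias indicesS big_cat /=; ring. Qed.

Lemma bias_split N N' : (N <= N')%N ->
  bias N = bias N' + \sum_(N <= j < N') \sum_(i <- level j) theta i ^+ 2.
Proof.
move=> /subnK <-; elim: (N' - N)%N => [|k IH]; first by rewrite add0n big_geq // addr0.
by rewrite addSn big_nat_recr /= ?leq_addl // IH biasS; ring.
Qed.

Lemma bias_le N N' : (N <= N')%N -> bias N' <= bias N.
Proof.
move=> /bias_split ->; rewrite lerDl; apply: sumr_ge0 => j _.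
by apply: sumr_ge0 => i _; rewrite sqr_ge0.
Qed.

Lemma level_beta J : \sum_(i <- level J) theta i ^+ 2 =
  \sum_(k < 2 ^ J) beta phi psi s k ^+ 2.
Proof. by rewrite big_map big_enum. Qed.

(** By density, [s] is close to some finite combination of wavelets, and such a
combination lies in a model. *)
Lemma bias_vanishing e : 0 < e -> exists N, bias N < e.
Proof.
move=> e0; have [_ _ dense] := onb.
have [|g [n [c [h [Hh gE]]]]] := dense s s_L2 (Num.sqrt e); first by rewrite sqrtr_gt0.
move=> /L2norm_lt_sqr; rewrite sqrtr_gt0 => /(_ e0); rewrite sqr_sqrtr ?ltW // => dsg.
have /choice [i_ Hi] : forall k, exists i, wave i = h k.
  by move=> k; have [i _ <-] := Hh k; exists i.
pose lev (i : windex) := if i is Some jk then (tag jk).+1 else 0%N.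
pose N := \max_k lev (i_ k).
have : model phi psi N g.
  exists n, c, h; split => // k; exists (i_ k) => //.
  have : (lev (i_ k) <= N)%N by rewrite /N (bigD1 k) //= leq_maxl.
  by rewrite /lev /=; case: (i_ k).
move=> /modelP[c' gc']; exists N; apply: le_lt_trans dsg.
have -> : dotp leb01 (s \- g) (s \- g) = L2norm leb01 (g \- s) ^+ 2.
  by rewrite L2norm_sqr; congr fine; apply: eq_integral => x _ /=; congr EFin; ring.
rewrite gc' dist_model lerDl; apply: sumr_ge0 => i _; exact: sqr_ge0.
Qed.

End bias.

End wavelet_models.

(** * Penalty constants and resolution levels *)

Section exponential_sums.
Context {R : realType}.
Implicit Types q : R.

Let expRM_pow2 q N : expR (- (q * (2 ^ N)%:R / 2)) = expR (- (q / 2)) ^+ (2 ^ N).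
Proof. by rewrite -expRM_natl; congr expR; rewrite mulrN mulrAC mulrC. Qed.

Let sum_expR_take q m m' : (m' <= m)%N ->
  \sum_(N < m) expR (- (q * (2 ^ N)%:R / 2)) < 1 ->
  \sum_(N < m') expR (- (q * (2 ^ N)%:R / 2)) < 1.
Proof.
move=> mm; apply: le_lt_trans; rewrite -!(big_mkord xpredT (fun N => expR (- (q * (2 ^ N)%:R / 2)))).
rewrite (big_cat_nat (leq0n m') mm) /= lerDl.
by apply: sumr_ge0 => N _; exact: expR_ge0.
Qed.

(** For [q <= 1] the first three weights are at least [y], [y ^+ 2] and [y ^+ 4]
with [y = expR (- 1 / 2)], whose sum exceeds [1]. *)
Lemma sum3_expR_lt1 q m : (3 <= m)%N ->
  \sum_(N < m) expR (- (q * (2 ^ N)%:R / 2)) < 1 -> 1 < q.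
Proof.
move=> m3 /(sum_expR_take m3); apply: contraTT; rewrite -!leNgt => q1.
rewrite !big_ord_recl big_ord0 !expRM_pow2 /=.
(* the bound [1 + x <= expR x] is too weak at [x = - 1 / 2] but sufficient
   at [x = - 1 / 8] *)
have y0 : 7 / 8 <= expR (- (q / 8)).
  by apply: le_trans (expR_ge1Dx _); lra.
have -> : expR (- (q / 2)) = expR (- (q / 8)) ^+ 4.
  by rewrite -expRM_natl; congr expR; field.
rewrite addr0 -!exprM.
have F k : (7 / 8) ^+ k <= expR (- (q / 8)) ^+ k by rewrite lerXn2r ?nnegrE ?expR_ge0 //; lra.
apply: le_trans (lerD (F _) (lerD (F _) (F _))).
by rewrite !exprnP; lra.
Qed.

Lemma sum2_expR_lt1 q m : (2 <= m)%N ->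
  \sum_(N < m) expR (- (q * (2 ^ N)%:R / 2)) < 1 -> 1 / 4 < q.
Proof.
move=> m2 /(sum_expR_take m2); apply: contraTT; rewrite -!leNgt => q1.
rewrite !big_ord_recl big_ord0 /= addr0.
have F (x : R) := expR_ge1Dx x.
by apply: le_trans (lerD (F _) (F _)); rewrite /=; lra.
Qed.

End exponential_sums.

Section resolution_levels.
Context {R : realType}.
Variables (lambda : nat -> R) (j0 : nat -> int).
Hypothesis lambda_gt0 : forall n, (1 <= n)%N -> 0 < lambda n.
Hypothesis lambda_mono : forall n n', (1 <= n)%N -> (n <= n')%N ->
  lambda n <= lambda n'.
Hypothesis lambda_lim : (fun n : nat => n%:R^-1 * lambda n) @ \oo --> (0 : R).
Hypothesis j0_mono : forall n n', (1 <= n)%N -> (n <= n')%N -> j0 n <= j0 n'.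
Hypothesis j0_def : forall n, (1 <= n)%N ->
  (2 : R) ^ (j0 n) <= n%:R * (lambda n)^-1 /\
  n%:R * (lambda n)^-1 < (2 : R) ^ (j0 n + 1).

Let pow2_lt (a b : int) : ((2 : R) ^ a < 2 ^ b) = (a < b).
Proof. by rewrite ltr_eXz2l // ltr1n. Qed.

Let pow2_le (a b : int) : ((2 : R) ^ a <= 2 ^ b) = (a <= b).
Proof. by rewrite ler_eXz2l // ltr1n. Qed.

Let natr_gt0 n : (1 <= n)%N -> (0 : R) < n%:R.
Proof. by rewrite ltr0n. Qed.

Lemma j0_unbounded (J : nat) : exists n, (1 <= n)%N /\ J%:Z <= j0 n.
Proof.
have /cvgrPdist_lt /(_ ((2 : R) ^- J)) := lambda_lim.
rewrite invr_gt0 exprn_gt0 // => /(_ isT) [n1 _ Hn1].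
exists (maxn n1 1); have n1' : (1 <= maxn n1 1)%N by rewrite leq_maxr.
split => //; have := Hn1 (maxn n1 1) (leq_maxl _ _).
set n := maxn n1 1 in n1' *.
have l0 := lambda_gt0 n1'; have n0 := natr_gt0 n1'.
have u0 : 0 <= n%:R^-1 * lambda n by rewrite mulr_ge0 ?invr_ge0 // ltW.
rewrite /= sub0r normrN ger0_norm // => H.
have : (2 : R) ^ J%:Z < 2 ^ (j0 n + 1).
  apply: lt_trans (j0_def n1').2.
  rewrite ltr_pdivlMr // -ltr_pdivlMl ?exprn_gt0 // -ltr_pdivrMr //.
  by rewrite mulrC.
by rewrite pow2_lt ltzD1.
Qed.

Lemma j0_succ_le n : (1 <= n)%N -> j0 n.+1 <= j0 n + 1.
Proof.
move=> n1; have l0 := lambda_gt0 n1; have n0 := natr_gt0 n1.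
have : (2 : R) ^ (j0 n.+1) < 2 ^ (j0 n + 1 + 1).
  apply: le_lt_trans (j0_def (leqW n1)).1 _.
  rewrite expfzDr ?pnatr_eq0 // expr1z.
  have H := (j0_def n1).2; apply: (@le_lt_trans _ _ (n%:R / lambda n * 2)).
    have l1 := lambda_gt0 (leqW n1).
    rewrite mulrAC; apply: ler_pM => //; first by rewrite invr_ge0 ltW.
      by rewrite -natrM ler_nat; lia.
    by rewrite lef_pV2 ?posrE // lambda_mono.
  by rewrite ltr_pM2r.
by rewrite pow2_lt ltzD1.
Qed.

Lemma lambda_succ_lt4 n : (1 <= n)%N -> lambda n.+1 < 4 * lambda n.
Proof.
move=> n1; have l0 := lambda_gt0 n1; have n0 := natr_gt0 n1.
have l1 := lambda_gt0 (leqW n1).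
have : n%:R / lambda n < 2 * (n.+1%:R / lambda n.+1).
  apply: lt_le_trans (j0_def n1).2 _.
  rewrite expfzDr ?pnatr_eq0 // expr1z mulrC ler_pM2l //.
  by apply: le_trans (j0_def (leqW n1)).1; rewrite pow2_le j0_mono.
rewrite ltr_pdivrMr // mulrA mulrAC ltr_pdivlMr // => H.
have : n%:R * lambda n.+1 < n%:R * (4 * lambda n).
  apply: lt_le_trans H _.
  have : n.+1%:R <= 2 * n%:R :> R by rewrite -natrM ler_nat; lia.
  by move: n.+1%:R => m mn; nra.
by rewrite ltr_pM2l.
Qed.

Section weights.
Variable kappa : R.
Hypothesis kappa_gt1 : 1 < kappa.
Hypothesis weights_lt1 : forall n m, (1 <= n)%N -> j0 n = m%:Z ->
  \sum_(N < m) expR (- ((Num.sqrt (kappa^-1 * lambda n) - 1) ^+ 2 * (2 ^ N)%:R / 2)) < 1.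

Let kappa_gt0 : 0 < kappa.
Proof. exact: lt_trans kappa_gt1. Qed.

Let t_sqr n : (1 <= n)%N -> Num.sqrt (kappa^-1 * lambda n) ^+ 2 = kappa^-1 * lambda n.
Proof. by move=> n1; rewrite sqr_sqrtr // mulr_ge0 ?invr_ge0 ?ltW // lambda_gt0. Qed.

(** With [t = Num.sqrt (kappa^-1 * lambda n)], the weights give [1 < (t - 1) ^+ 2],
and [t] being nonnegative this excludes small values of [t] as well as those
near [1]: there remains [2 < t]. *)
Lemma penalty_lower_bound n : (1 <= n)%N -> 3 <= j0 n -> 4 * kappa < lambda n.
Proof.
move=> n1 j3; case E: (j0 n) j3 => [m|//] m3.
have := sum3_expR_lt1 m3 (weights_lt1 n1 E).
have := t_sqr n1; have := sqrtr_ge0 (kappa^-1 * lambda n).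
move: (Num.sqrt _) => t t0 t2 q1.
have t_gt2 : 2 < t by nra.
have : 4 < kappa^-1 * lambda n by rewrite -t2; nra.
by rewrite mulrC ltr_pdivlMr // mulrC.
Qed.

(** If the maximal level started above [1] it would remain so, and the weights of
two models would keep [kappa^-1 * lambda n] out of [[1 / 4, 1]]. This quantity
would start below that gap, and could not jump over it since [lambda] is
multiplied by less than [4] at each step, in contradiction with
[penalty_lower_bound]. *)
Lemma j0_1_le1 : j0 1 <= 1.
Proof.
rewrite leNgt; apply/negP => j1.
have small n : (1 <= n)%N -> kappa^-1 * lambda n < 1 / 4.
  elim: n => // -[_ _|n IH _].
    have : (2 : R) ^ 2%:Z <= (lambda 1)^-1.
      apply: le_trans (_ : 2 ^ j0 1 <= _); first by rewrite pow2_le.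
      by have := (j0_def (leqnn 1)).1; rewrite mul1r.
    have l0 := lambda_gt0 (leqnn 1).
    rewrite -[X in X <= _]invrK lef_pV2 ?posrE ?invr_gt0 ?exprn_gt0 // => l4.
    rewrite mulrC ltr_pdivrMr //; apply: le_lt_trans l4 _.
    have -> : ((2 : R) ^ 2%:Z)^-1 = 1 / 4 by rewrite -exprnP; field.
    by have := kappa_gt1; lra.
  have H := IH isT; have n1 : (1 <= n.+2)%N by [].
  have l4 : kappa^-1 * lambda n.+2 < 1.
    rewrite mulrC ltr_pdivrMr // mul1r (lt_trans (lambda_succ_lt4 _)) //.
    have : lambda n.+1 < 1 / 4 * kappa by rewrite -ltr_pdivrMr // mulrC.
    lra.
  have j2 : 2 <= j0 n.+2 by apply: le_trans (j0_mono (leqnn 1) n1).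
  case E: (j0 n.+2) j2 => [m|//] m2.
  have := sum2_expR_lt1 m2 (weights_lt1 n1 E).
  move: l4; have := t_sqr n1; have := sqrtr_ge0 (kappa^-1 * lambda n.+2).
  by move: (Num.sqrt _) => t t0 <- ? ?; nra.
have [n [n1 j3]] := j0_unbounded 3.
have l4 := penalty_lower_bound n1 j3.
have : lambda n < 1 / 4 * kappa by rewrite -ltr_pdivrMr // mulrC small.
have := kappa_gt0; lra.
Qed.

(** The maximal level starts at [1] or less, is unbounded, and increases by at
most [1] at each step. *)
Lemma j0_eq1 : exists n, (1 <= n)%N /\ j0 n = 1.
Proof.
have [n [n1 jn]] := j0_unbounded 1.
elim: n n1 jn => // -[_ _ j1|n IH _ jn].
  by exists 1%N; split => //; apply/eqP; rewrite eq_le j1 j0_1_le1.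
have [j1|j1] := leP 1 (j0 n.+1); first exact: IH.
exists n.+2; split => //; apply/eqP; rewrite eq_le jn andbT.
by apply: le_trans (j0_succ_le _) _ => //; rewrite -[X in _ <= X]add0r lerD2r -ltzD1.
Qed.

End weights.

End resolution_levels.

(** * Rates *)

Section rates.
Context {R : realType}.
Implicit Types (u x y : R).

Lemma powR_pow2 (J : nat) (x : R) : (2 ^ J)%:R `^ x = (2 `^ x) ^+ J :> R.
Proof.
elim: J => [|J IH]; first by rewrite expn0 powR1 expr0.
by rewrite expnS natrM powRM ?ler0n // IH exprS.
Qed.

Lemma split_powR u (a b : R) : 0 < u -> a + b = 1 -> u = u `^ a * u `^ b.
Proof.
move=> u0 ab; rewrite -powRD; first by rewrite ab powRr1 // ltW.
by apply/implyP => _; rewrite gt_eqF.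
Qed.

(** One step multiplies [u k * 2 ^ N k / u k `^ g] by at most
[(u k.+1 / u k) `^ (1 - g) <= (1 - delta) `^ (1 - g) < 1], up to an additive
term bounded by [C * K * 2 `^ g]; the condition on [Z] is that [Z] be stable
under this affine map. *)
Lemma dimension_rate (u : nat -> R) (N : nat -> nat) (b : nat -> R)
    (g delta C K Z : R) :
    0 < g -> g < 1 -> 0 < delta -> delta <= 1 / 2 -> 0 <= C -> 0 <= K ->
    (forall k, 0 < u k) -> (forall k, u k.+1 <= (1 - delta) * u k) ->
    (forall k, u k <= 2 * u k.+1) ->
    (forall k, b (N k) <= K * u k `^ g) ->
    (forall k, (2 ^ N k.+1)%:R <= (2 ^ N k)%:R + C / u k.+1 * b (N k)) ->
    u 0%N * (2 ^ N 0%N)%:R <= Z * u 0%N `^ g -> 0 <= Z ->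
    C * K * 2 `^ g <= Z * (1 - (1 - delta) `^ (1 - g)) ->
  forall k, u k * (2 ^ N k)%:R <= Z * u k `^ g.
Proof.
move=> g0 g1 d0 d2 C0 K0 u0 ud u2 bN NS Z0 Zge0 ZC; elim=> // k IH.
have uk := u0 k; have uk' := u0 k.+1.
pose r := u k.+1 / u k.
have r0 : 0 < r by rewrite divr_gt0.
have ur : u k.+1 = r * u k by rewrite /r divfK // gt_eqF.
have rd : r <= 1 - delta by rewrite /r ler_pdivrMr.
have ug : u k.+1 `^ g = r `^ g * u k `^ g by rewrite ur powRM // ltW.
have rs : r = r `^ (1 - g) * r `^ g by apply: split_powR; rewrite ?subrK.
have rg : r `^ (1 - g) <= (1 - delta) `^ (1 - g).
  by apply: ge0_ler_powR; rewrite ?nnegrE ?subr_ge0 ?(ltW r0) ?(ltW g1) //; lra.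
have uk2 : u k `^ g <= 2 `^ g * u k.+1 `^ g.
  rewrite -powRM ?(ltW uk') //; apply: ge0_ler_powR; rewrite ?nnegrE ?(ltW g0) ?(ltW uk) //.
  by rewrite mulr_ge0 // ltW.
have step1 : u k.+1 * (2 ^ N k)%:R <= (1 - delta) `^ (1 - g) * Z * u k.+1 `^ g.
  rewrite ur -mulrA -ur ug {1}rs; apply: (@le_trans _ _ (r `^ (1 - g) * r `^ g * (Z * u k `^ g))).
    by apply: ler_wpM2l => //; rewrite mulr_ge0 ?powR_ge0.
  rewrite (_ : _ * (Z * _) = r `^ (1 - g) * (Z * (r `^ g * u k `^ g))); last by ring.
  rewrite -[leRHS]mulrA; apply: ler_wpM2r => //.
  by rewrite mulr_ge0 // mulr_ge0 // powR_ge0.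
have step2 : C * b (N k) <= C * K * 2 `^ g * u k.+1 `^ g.
  rewrite -!mulrA; apply: ler_wpM2l => //; apply: le_trans (bN k) _.
  by apply: ler_wpM2l.
have step3 : C * K * 2 `^ g * u k.+1 `^ g <=
    Z * (1 - (1 - delta) `^ (1 - g)) * u k.+1 `^ g.
  by apply: ler_wpM2r => //; rewrite powR_ge0.
have := NS k; rewrite -(ler_pM2l uk') mulrDr.
rewrite (_ : u k.+1 * (C / u k.+1 * b (N k)) = C * b (N k)); last first.
  by field; rewrite gt_eqF.
move=> H; apply: le_trans H _; apply: le_trans (lerD step1 (le_trans step2 step3)) _.
by rewrite le_eqVlt; apply/orP; left; apply/eqP; ring.
Qed.

(** Level [J] is compared with the last [k] before [Z <= 2 ^ J * u k `^ w] fails: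
for this [k] the dimension bound gives [N k <= J], while the failure of the
inequality at [k.+1] bounds [u k], which is at most twice [u k.+1]. If there is
no such [k], then [2 ^ J] is bounded and the bound [B0] is enough. *)
Lemma bias_rate (u : nat -> R) (N : nat -> nat) (b : nat -> R)
    (alpha w g delta K Z B0 : R) :
    0 < alpha -> 0 < w -> g = 2 * alpha * w -> w + g = 1 ->
    0 < delta -> delta <= 1 / 2 -> 0 <= K -> 0 < Z ->
    (forall k, 0 < u k) -> (forall k, u k.+1 <= (1 - delta) * u k) ->
    (forall k, u k <= 2 * u k.+1) ->
    (forall k, b (N k) <= K * u k `^ g) ->
    (forall k, u k * (2 ^ N k)%:R <= Z * u k `^ g) ->
    (forall i j, (i <= j)%N -> b j <= b i) -> (forall i, 0 <= b i) -> b 0%N <= B0 -> 0 <= B0 ->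
  forall J, (2 `^ (2 * alpha)) ^+ J * b J <=
    B0 * (Z / u 0%N `^ w) `^ (2 * alpha) + K * 2 `^ g * Z `^ (2 * alpha).
Proof.
move=> a0 w0 gE wg d0 d2 K0 Z0 u0 ud u2 bN NZ bdec b0 bB B00 J.
have a20 : 0 <= 2 * alpha by rewrite mulr_ge0 // ltW.
have g0 : 0 <= g by rewrite gE mulr_ge0 // ltW.
rewrite -powR_pow2; set y : R := (2 ^ J)%:R.
have y0 : 0 < y by rewrite ltr0n expn_gt0.
pose P k := y * u k `^ w < Z.
have exP : exists k, P k.
  have ugeo k : u k <= (1 - delta) ^+ k * u 0%N.
    elim: k => [|k IH]; first by rewrite expr0 mul1r.
    by apply: le_trans (ud k) _; rewrite exprS -mulrA ler_wpM2l //; lra.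
  have : (1 - delta) ^+ k @[k --> \oo] --> (0 : R).
    by apply: cvg_expr; rewrite ger0_norm; lra.
  move=> /cvgrPdist_lt /(_ ((Z / y) `^ w^-1 / u 0%N)).
  case; first by rewrite divr_gt0 // powR_gt0 // divr_gt0.
  move=> k _ /(_ k (leqnn k)); rewrite sub0r normrN => Hk; exists k; rewrite /P.
  rewrite mulrC -ltr_pdivlMr //.
  have -> : Z / y = ((Z / y) `^ w^-1) `^ w.
    by rewrite -powRrM mulVf ?gt_eqF // powRr1 // divr_ge0 // ltW.
  apply: gt0_ltr_powR; rewrite ?nnegrE ?powR_ge0 ?(ltW (u0 k)) //.
  apply: le_lt_trans (ugeo k) _; rewrite -ltr_pdivlMr //.
  by apply: le_lt_trans Hk; exact: ler_norm.
case: (ex_minnP exP) => -[|k] Pk kmin.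
  apply: (@le_trans _ _ (B0 * (Z / u 0%N `^ w) `^ (2 * alpha))); last first.
    by rewrite lerDl mulr_ge0 ?powR_ge0 // mulr_ge0 // powR_ge0.
  rewrite mulrC; apply: ler_pM; rewrite ?powR_ge0 //.
    by apply: le_trans (bdec 0%N J _) bB.
  apply: ge0_ler_powR; rewrite ?nnegrE ?(ltW y0) ?divr_ge0 ?powR_ge0 ?(ltW Z0) //.
  by rewrite ler_pdivlMr ?powR_gt0 // ltW.
have nPk : Z <= y * u k `^ w.
  by rewrite leNgt; apply/negP => /kmin; rewrite ltnn.
have NJ : (N k <= J)%N.
  rewrite -(@leq_exp2l 2) // -(ler_nat R) -/y.
  rewrite -(ler_pM2l (u0 k)); apply: le_trans (NZ k) _.
  rewrite {2}(split_powR (u0 k) wg) mulrC mulrAC [leRHS]mulrC.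
  apply: le_trans (_ : _ <= u k `^ g * (y * u k `^ w)) _.
    by apply: ler_wpM2l; rewrite ?powR_ge0.
  by rewrite le_eqVlt; apply/orP; left; apply/eqP; ring.
apply: (@le_trans _ _ (K * 2 `^ g * Z `^ (2 * alpha))); last first.
  by rewrite lerDr mulr_ge0 ?powR_ge0.
apply: (@le_trans _ _ (y `^ (2 * alpha) * (K * 2 `^ g * u k.+1 `^ g))).
  apply: ler_wpM2l; rewrite ?powR_ge0 //; apply: le_trans (bdec _ _ NJ) _.
  apply: le_trans (bN k) _; rewrite -mulrA; apply: ler_wpM2l => //.
  rewrite -powRM ?(ltW (u0 _)) //; apply: ge0_ler_powR; rewrite ?nnegrE ?(ltW (u0 _)) //.
  by rewrite mulr_ge0 // ltW.
rewrite mulrCA; apply: ler_wpM2l; first by rewrite mulr_ge0 ?powR_ge0.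
have -> : u k.+1 `^ g = (u k.+1 `^ w) `^ (2 * alpha) by rewrite -powRrM gE mulrC.
rewrite -powRM ?powR_ge0 ?(ltW y0) //; apply: ge0_ler_powR; rewrite ?nnegrE ?(ltW Z0) //.
  by rewrite mulr_ge0 ?powR_ge0 // ltW.
exact: ltW.
Qed.

End rates.

Section oracle_level.
Context {R : realType}.

Lemma one_powR (x : R) : 1 `^ x = 1.
Proof. by rewrite powR1. Qed.

Lemma natr_le_exp (c : R) n : 0 <= c -> c * n%:R <= (1 + c) ^+ n.
Proof.
move=> c0; suff : 1 + c * n%:R <= (1 + c) ^+ n by lra.
elim: n => [|n IH]; first by rewrite mulr0 addr0 expr0.
rewrite exprS; apply: le_trans (_ : (1 + c) * (1 + c * n%:R) <= _); last first.
  by apply: ler_wpM2l => //; lra.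
rewrite -natr1; have := ler0n R n; move: n%:R => x x0.
have cx : 0 <= c * (c * x) by rewrite !mulr_ge0.
lra.
Qed.

(** The level balancing bias and penalty: the largest [N < m] such that
[2 ^ N <= u ^ (- w)], which is of the order of [u ^ (- w)] because
[u ^ (- w) <= u ^ (- 1) < 2 ^ (m + 1)]. *)
Lemma balanced_level (m : nat) (u w : R) :
    (1 <= m)%N -> 0 < u -> 0 < w -> w <= 1 ->
    (2 ^ m)%:R * u <= 1 -> 1 < (2 ^ m.+1)%:R * u ->
  exists N, [/\ (N < m)%N, (2 ^ N)%:R * u `^ w <= 1 & 1 <= 4 * ((2 ^ N)%:R * u `^ w)].
Proof.
move=> m1 u0 w0 w1 mu mu1.
have u1 : u <= 1.
  apply: le_trans mu; rewrite ler_peMl ?(ltW u0) //.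
  by rewrite ler1n expn_gt0.
have uw : u `^ w <= 1.
  by rewrite -[leRHS](one_powR w); apply: ge0_ler_powR; rewrite ?nnegrE ?(ltW u0) ?(ltW w0).
have [N [Nm N1 Nmax]] : exists N, [/\ (N < m)%N, (2 ^ N)%:R * u `^ w <= 1 &
    N.+1 = m \/ 1 < (2 ^ N.+1)%:R * u `^ w].
  elim: m m1 {mu mu1} => // -[_ _|m IH _].
    by exists 0%N; split; rewrite ?mul1r //; left.
  have [N [Nm N1 [Em|Nb]]] := IH isT; last by exists N; split; [exact: leqW| |right].
  have [H|H] := leP ((2 ^ m.+1)%:R * u `^ w) 1; first by exists m.+1; split => //; left.
  by exists N; split; [exact: leqW| |right; rewrite Em].
exists N; split => //; case: Nmax => [Em|].
  rewrite -Em !expnS !natrM in mu1.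
  have uuw : u <= u `^ w by apply: ger1_powR => //; rewrite u0.
  have : 0 <= (2 ^ N)%:R * (u `^ w - u) by rewrite mulr_ge0 // subr_ge0.
  by move: mu1; lra.
rewrite expnS natrM => H; have : 0 <= (2 ^ N)%:R * u `^ w by rewrite mulr_ge0 ?powR_ge0.
lra.
Qed.

(** At the balanced level the bias and the penalty are both of the order of
[u `^ g]; so is [u * m], because [m] is at most of the order of [(2 ^ m) `^ w],
hence of [u `^ (- w)]. *)
Lemma oracle_rate (m : nat) (u alpha w g Cb : R) (b : nat -> R) :
    0 < alpha -> 0 < w -> w <= 1 -> g = 2 * alpha * w -> w + g = 1 -> 0 <= Cb ->
    (1 <= m)%N -> 0 < u ->
    (2 ^ m)%:R * u <= 1 -> 1 < (2 ^ m.+1)%:R * u ->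
    (forall N, (2 `^ (2 * alpha)) ^+ N * b N <= Cb) ->
  exists N, (N < m)%N /\
    b N + u * (2 ^ N)%:R + u * m%:R <=
    (Cb * 4 `^ (2 * alpha) + 1 + (2 `^ w - 1)^-1) * u `^ g.
Proof.
move=> a0 w0 w1 gE wg Cb0 m1 u0 mu mu1 bC.
have a20 : 0 <= 2 * alpha by rewrite mulr_ge0 // ltW.
have [N [Nm NU NL]] := balanced_level m1 u0 w0 w1 mu mu1.
exists N; split => //.
have ug0 : 0 <= u `^ g by exact: powR_ge0.
have us := split_powR u0 wg.
have p0 : (0 : R) < (2 ^ N)%:R by rewrite ltr0n expn_gt0.
rewrite [leRHS]mulrDl [X in _ <= X + _]mulrDl mul1r; apply: lerD; first apply: lerD.
- have Q0 : 0 < (2 `^ (2 * alpha)) ^+ N :> R by rewrite exprn_gt0 // powR_gt0.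
  rewrite -(ler_pM2l Q0); apply: le_trans (bC N) _.
  rewrite -powR_pow2.
  rewrite [leRHS](_ : _ = Cb * (4 * ((2 ^ N)%:R * u `^ w)) `^ (2 * alpha)); last first.
    rewrite !powRM ?mulr_ge0 ?powR_ge0 ?(ltW p0) // -powRrM -[w * _]mulrC -gE.
    by ring.
  rewrite ler_peMr // -[leLHS](one_powR (2 * alpha)); apply: ge0_ler_powR; rewrite ?nnegrE //.
  by rewrite mulr_ge0 // mulr_ge0 ?powR_ge0 // ltW.
- rewrite [u in leLHS]us mulrAC -[leRHS]mul1r; apply: ler_wpM2r => //.
  by rewrite mulrC.
- rewrite [u in leLHS]us mulrAC; apply: ler_wpM2r => //.
  have c0 : 0 < 2 `^ w - 1 :> R.
    by rewrite subr_gt0 -[ltLHS](one_powR w); apply: gt0_ltr_powR; rewrite ?nnegrE // ltr1n.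
  rewrite -[leRHS]mulr1 ler_pdivlMl //.
  apply: (@le_trans _ _ ((2 `^ w) ^+ m * u `^ w)).
    rewrite mulrCA mulrC; apply: ler_wpM2r; first exact: powR_ge0.
    by have := @natr_le_exp (2 `^ w - 1) m (ltW c0); rewrite [1 + _]addrC subrK.
  rewrite -powR_pow2 -powRM ?(ltW u0) //.
  rewrite -[leRHS](one_powR w); apply: ge0_ler_powR; rewrite ?nnegrE ?(ltW w0) //.
  by rewrite mulr_ge0 // ltW.
Qed.

(** Sum the levels from [N] on; what remains beyond them is arbitrarily small. *)
Lemma geometric_bias (b lev : nat -> R) (q M : R) :
    0 < q -> q < 1 -> (forall J, b J = b J.+1 + lev J) ->
    (forall i j, (i <= j)%N -> b j <= b i) ->
    (forall e, 0 < e -> exists N, b N < e) -> (forall J, lev J <= M * q ^+ J) ->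
  forall N, b N <= M / (1 - q) * q ^+ N.
Proof.
move=> q0 q1 bS bdec b0 levq N.
have q1' : 1 - q != 0 by rewrite subr_eq0 eq_sym lt_eqF.
have tele k : b N <= b (N + k)%N + M / (1 - q) * (q ^+ N - q ^+ (N + k)).
  elim: k => [|k IH]; first by rewrite addn0 subrr mulr0 addr0.
  apply: le_trans IH _; rewrite bS addnS; have := levq (N + k)%N.
  have -> : M / (1 - q) * (q ^+ N - q ^+ (N + k).+1) =
    M / (1 - q) * (q ^+ N - q ^+ (N + k)) + M * q ^+ (N + k) by rewrite exprS; field.
  lra.
have M0 : 0 <= M.
  have := levq 0%N; rewrite expr0 mulr1; apply: le_trans.
  by rewrite -(lerD2l (b 1%N)) addr0 -bS bdec.
apply/ler_addgt0Pr => e e0; have [N1 bN1] := b0 e e0.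
apply: le_trans (tele N1) _; rewrite addrC; apply: lerD; last first.
  by apply: le_trans (ltW bN1); apply: bdec; rewrite leq_addl.
apply: ler_wpM2l; first by rewrite divr_ge0 // subr_ge0 ltW.
by rewrite lerBlDr lerDl exprn_ge0 // ltW.
Qed.

End oracle_level.

(** * Penalized comparison of two levels *)

Section penalized_comparison.
Context {R : realType}.
(* [th] stands for the coefficients of the signal, [ep] for those of the noise,
   [v] for the inverse of the sample size and [c] for a square root of it *)
Variables (th ep : windex -> R) (c v lam : R).
Hypothesis c_sqr : c ^+ 2 = v.
Hypothesis v_ge0 : 0 <= v.
Notation y := (fun i => th i + c * ep i).
Notation energy f j := (\sum_(i <- level j) f i ^+ 2).

Lemma sum_indices_split (f : windex -> R) N N' : (N <= N')%N ->
  \sum_(i <- indices N') f i = \sum_(i <- indices N) f i +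
    \sum_(N <= j < N') \sum_(i <- level j) f i.
Proof.
move=> /subnK <-; elim: (N' - N)%N => [|k IH]; first by rewrite add0n big_geq // addr0.
by rewrite addSn big_nat_recr /= ?leq_addl // indicesS big_cat /= IH addrA.
Qed.

Lemma sum_pow2 N N' : (N <= N')%N ->
  \sum_(N <= j < N') (2 ^ j)%:R = (2 ^ N')%:R - (2 ^ N)%:R :> R.
Proof.
move=> /subnK <-; elim: (N' - N)%N => [|k IH]; first by rewrite add0n big_geq // subrr.
rewrite addSn big_nat_recr /= ?leq_addl // IH expnS natrM; ring.
Qed.

(** The penalized contrast of level [N], by [penalizedE]. *)
Definition criterion N : R := - \sum_(i <- indices N) y i ^+ 2 + lam * v * (2 ^ N)%:R.

Lemma criterion_le N N' : (N <= N')%N -> criterion N' <= criterion N ->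
  lam * v * ((2 ^ N')%:R - (2 ^ N)%:R) <= \sum_(N <= j < N') energy y j.
Proof.
move=> NN; rewrite /criterion (sum_indices_split _ NN); lra.
Qed.

Lemma criterion_ge N N' : (N <= N')%N -> criterion N <= criterion N' ->
  \sum_(N <= j < N') energy y j <= lam * v * ((2 ^ N')%:R - (2 ^ N)%:R).
Proof.
move=> NN; rewrite /criterion (sum_indices_split _ NN); lra.
Qed.

(** The factor [2 * kappa / (kappa - 1)] is the inverse of the fraction of the
penalty that is left in [overselection_bound]; the other one bounds both
constants of Young's inequality, [1 + eta] and [1 + eta^-1] with
[eta = (kappa - 1) / 2]. *)
Definition overselection_factor (kappa : R) : R :=
  2 * kappa / (kappa - 1) * (1 + (kappa - 1) / 2 + 2 / (kappa - 1)).

Lemma overselection_factor_ge0 kappa : 1 < kappa -> 0 <= overselection_factor kappa.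
Proof.
move=> k1; have k0 : 0 < kappa - 1 by rewrite subr_gt0.
have kp : 0 < kappa by exact: lt_trans k1.
by rewrite mulr_ge0 // ?addr_ge0 // ?divr_ge0 // ?mulr_ge0 // ltW.
Qed.

(** The criterion goes down from level [N] to [N'] only if the levels in between
carry signal or exceptional noise: ordinary noise is dominated by the penalty
since [1 < kappa], and Young's inequality with the weight [(kappa - 1) / 2]
leaves a fraction of the penalty to spare. *)
Lemma overselection_bound (kappa : R) (excess : nat -> R) N N' :
    1 < kappa -> (N <= N')%N -> criterion N' <= criterion N ->
    (forall j, (N <= j < N')%N -> energy ep j <= kappa^-1 * lam * (2 ^ j)%:R + excess j) ->
    (forall j, 0 <= excess j) ->
  lam * v * ((2 ^ N')%:R - (2 ^ N)%:R) <=
  overselection_factor kappa *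
    (\sum_(N <= j < N') energy th j + v * \sum_(N <= j < N') excess j).
Proof.
rewrite /overselection_factor => k1 NN crit epj ex0.
have k0 : 0 < kappa - 1 by rewrite subr_gt0.
have kp : 0 < kappa by exact: lt_trans k1.
pose eta := (kappa - 1) / 2.
have eta0 : 0 < eta by rewrite divr_gt0.
have young (a b : R) : (a + b) ^+ 2 <= (1 + eta) * b ^+ 2 + (1 + eta^-1) * a ^+ 2.
  have : 0 <= eta^-1 * (a - eta * b) ^+ 2 by rewrite mulr_ge0 ?sqr_ge0 ?invr_ge0 // ltW.
  have -> : eta^-1 * (a - eta * b) ^+ 2 = eta^-1 * a ^+ 2 - 2 * a * b + eta * b ^+ 2.
    by field; rewrite gt_eqF.
  rewrite sqrrD !mulrDl !mul1r; lra.
have H := criterion_le NN crit.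
set D := _ - _ in H *; set TH := \sum_(N <= j < N') energy th j.
set EX := \sum_(N <= j < N') excess j.
have Hy : \sum_(N <= j < N') energy y j <=
    (1 + eta) * v * (kappa^-1 * lam * D + EX) + (1 + eta^-1) * TH.
  rewrite /D -sum_pow2 // mulr_sumr -big_split /= [X in _ <= X + _]mulr_sumr.
  rewrite [X in _ <= _ + X]mulr_sumr -big_split /=.
  rewrite big_nat_cond [leRHS]big_nat_cond; apply: ler_sum => j /andP[jN _].
  apply: (@le_trans _ _ ((1 + eta) * v * energy ep j + (1 + eta^-1) * energy th j)).
    rewrite !mulr_sumr -big_split /=; apply: ler_sum => i _.
    by have := young (th i) (c * ep i); rewrite exprMn c_sqr mulrA.
  rewrite lerD2r; apply: ler_wpM2l; last exact: epj.
  by rewrite mulr_ge0 // addr_ge0 // ltW.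
have TH0 : 0 <= TH.
  by apply: sumr_ge0 => j _; apply: sumr_ge0 => i _; exact: sqr_ge0.
have vEX0 : 0 <= v * EX by rewrite mulr_ge0 // sumr_ge0.
have H2 := le_trans H Hy.
have ei : eta^-1 = 2 / (kappa - 1) by rewrite /eta; field; rewrite gt_eqF.
set C := 1 + (kappa - 1) / 2 + 2 / (kappa - 1).
have key : (kappa - 1) / (2 * kappa) * (lam * v * D) <= C * (TH + v * EX).
  have -> : (kappa - 1) / (2 * kappa) * (lam * v * D) =
      lam * v * D - (1 + eta) * v * (kappa^-1 * lam * D).
    by rewrite /eta; field; rewrite gt_eqF.
  apply: (@le_trans _ _ ((1 + eta) * (v * EX) + (1 + eta^-1) * TH)).
    by move: H2; rewrite mulrDr; lra.
  have ei0 : 0 <= eta^-1 by rewrite invr_ge0 ltW.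
  rewrite /C -ei -/eta mulrDr addrC; apply: lerD; apply: ler_wpM2r => //; lra.
have K0 : 0 < (kappa - 1) / (2 * kappa) by rewrite divr_gt0 // mulr_gt0.
rewrite -(ler_pM2l K0); apply: le_trans key _.
rewrite le_eqVlt; apply/orP; left; apply/eqP; field.
by rewrite !gt_eqF.
Qed.

End penalized_comparison.

(** * Loss and risk of the selected estimator *)

Section arithmetic.
Context {R : realType}.

Lemma le_of_small_deviation (X D : R) : 0 < D ->
  (X - D) ^+ 2 < 9 * D ^+ 2 -> X <= 4 * D.
Proof.
move=> D0; apply: contraTT; rewrite -ltNge -leNgt => DX.
have -> : 9 * D ^+ 2 = (3 * D) ^+ 2 by ring.
by rewrite lerXn2r ?nnegrE; lra.
Qed.

Lemma sqr_le_double (x y : R) : x ^+ 2 <= 2 * (x + y) ^+ 2 + 2 * y ^+ 2.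
Proof. by have := sqr_ge0 (x + 2 * y); rewrite !expr2; lra. Qed.

(** The part of [X] beyond four times its mean [D] is at most a multiple of its
squared deviation, whose mean is proportional to [D]. *)
Lemma le_excess (X D : R) : 0 < D -> X <= 4 * D + (3 * D)^-1 * (X - D) ^+ 2.
Proof.
move=> D0; rewrite -lerBlDl ler_pdivlMl ?mulr_gt0 //.
have := sqr_ge0 (X - D - (3 / 2) * D); have := sqr_ge0 D.
by rewrite !expr2; lra.
Qed.

(** The last step of [risk_oracle] when the selected level is above the oracle:
[X] is the additional noise and [D] the additional penalty. *)
Lemma oracle_above_arith (C v b bN uD T E X D : R) :
    0 <= C -> 0 <= v -> 0 <= b -> 0 <= uD -> 0 <= T -> 0 <= E -> bN <= b ->
    v * X <= D + v * E -> D <= C * (b + v * E) ->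
  bN + v * (T + X) <= (2 + C) * v * T + (2 + C) * v * E + (2 + C) * (b + uD).
Proof.
move=> C0 v0 b0 uD0 T0 E0 bNb; rewrite mulrDr => vX DC.
have vT := mulr_ge0 v0 T0; have vE := mulr_ge0 v0 E0.
have CuD := mulr_ge0 C0 uD0; have CvT := mulr_ge0 C0 vT.
move: DC; rewrite mulrDr -!mulrA !mulrDl !mulrDr.
move: (v * X) (v * T) (v * E) (C * uD) (C * b) vX vT vE CuD CvT => vX vT vE CuD Cb.
lra.
Qed.

(** The last step of [risk_oracle] when the selected level is below the oracle:
[TH] is the missed signal and [X] the noise of the missed levels. *)
Lemma oracle_below_arith (C v b uD T E X TH : R) :
    0 <= C -> 0 <= v -> 0 <= b -> 0 <= uD -> 0 <= T -> 0 <= E -> 0 <= X ->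
    TH <= 2 * uD + 2 * (v * X) ->
  b + TH + v * T <= (2 + C) * v * (T + X) + (2 + C) * v * E + (2 + C) * (b + uD).
Proof.
move=> C0 v0 b0 uD0 T0 E0 X0.
have vT := mulr_ge0 v0 T0; have vE := mulr_ge0 v0 E0; have vX := mulr_ge0 v0 X0.
have CuD := mulr_ge0 C0 uD0; have CvT := mulr_ge0 C0 vT; have CvE := mulr_ge0 C0 vE.
have CvX := mulr_ge0 C0 vX; have Cb := mulr_ge0 C0 b0.
rewrite -!mulrA !mulrDl !mulrDr; lra.
Qed.

End arithmetic.

Section selected_model_loss.
Context {R : realType}.
Variables phi psi : R -> R.
Hypothesis onb : orthonormal_basis leb01 (L2 leb01) (wave phi psi).
Context {d : measure_display} {Omega : measurableType d}.
Variables (P : probability Omega R) (W : (R -> R) -> {RV P >-> R}).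
Hypothesis noise : white_noise (range (wave phi psi)) W.
Notation wave := (wave phi psi).
Notation eps i := (W (wave i) : Omega -> R).

Let wave_L2 i : L2 leb01 (wave i).
Proof. by case: onb. Qed.

Let noise_L2 i : L2 P (eps i).
Proof.
apply: L2_sqr_integrable; first exact: measurable_funP.
have := noise_cov noise (wave_L2 i) (wave_L2 i); rewrite unlock => H.
apply/integrableP; split.
  by apply/measurable_EFinP; apply: measurable_funX; exact: measurable_funP.
apply: (@le_lt_trans _ _ (\int[P]_w (W (wave i) w * W (wave i) w)%:E)%E).
  rewrite le_eqVlt; apply/orP; left; apply/eqP; apply: eq_integral => w _ /=.
  by rewrite ger0_norm ?sqr_ge0 // expr2.
by rewrite H ltry.
Qed.

Let noise_mean i : \int[P]_w eps i w = 0.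
Proof. by have := noise_centered noise (wave_L2 i); rewrite unlock /Rintegral => ->. Qed.

Let noise_dotp i j : dotp P (eps i) (eps j) = (i == j)%:R.
Proof.
have := noise_cov noise (wave_L2 i) (wave_L2 j); rewrite unlock => H.
by rewrite /dotp /Rintegral H; case: onb => _ /= ->.
Qed.

Let noise_pair i j (a b : R) :
  gaussian_variable P (fun w => a * eps i w + b * eps j w).
Proof.
pose u (k : 'I_2) := if k == ord0 then wave i else wave j.
pose c (k : 'I_2) := if k == ord0 then a else b.
have := @noise_gaussian _ _ _ _ _ _ noise 2 u c.
rewrite (_ : (fun w => \sum_(k < 2) c k * W (u k) w) =
  (fun w => a * eps i w + b * eps j w)).
  by apply=> k; rewrite /u; case: ifP.
by apply/funext => w; rewrite !big_ord_recl big_ord0 addr0.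
Qed.

Lemma noise_energy_mean (l : seq windex) :
  P.-integrable setT (EFin \o (fun w => \sum_(i <- l) eps i w ^+ 2)) /\
  \int[P]_w (\sum_(i <- l) eps i w ^+ 2) = (size l)%:R.
Proof. exact: (chi_square_mean noise_L2 noise_mean noise_dotp noise_pair). Qed.

Lemma noise_energy_variance (l : seq windex) : uniq l ->
  P.-integrable setT (EFin \o (fun w => (\sum_(i <- l) eps i w ^+ 2 - (size l)%:R) ^+ 2)) /\
  \int[P]_w ((\sum_(i <- l) eps i w ^+ 2 - (size l)%:R) ^+ 2) = 2 * (size l)%:R.
Proof. exact: (chi_square_variance noise_L2 noise_mean noise_dotp noise_pair). Qed.

Section fixed_size.
Variables (n : nat) (s : R -> R).
Hypotheses (n_gt0 : (1 <= n)%N) (s_L2 : L2 leb01 s).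
Notation obs w := (observation W n s w).
Notation theta i := (dotp leb01 s (wave i)).
Notation c := ((Num.sqrt n%:R)^-1 : R).
Notation v := (n%:R^-1 : R).

Lemma noise_scale_sqr : c ^+ 2 = v.
Proof. by rewrite exprVn sqr_sqrtr. Qed.

Lemma observation_linear w : linear_on_span (range wave) (obs w).
Proof.
move=> a b f g Sf Sg; rewrite /observation (noise_linear noise w) //.
have span_L2 h : span (range wave) h -> L2 leb01 h.
  move=> [k [x [e [He ->]]]]; apply: L2_sum => i.
  by have [j _ <-] := He i.
by rewrite (dotp_linearl a b (span_L2 _ Sf) (span_L2 _ Sg) s_L2); ring.
Qed.

Lemma observation_wave w i : obs w (wave i) = theta i + c * eps i w.
Proof. by rewrite /observation dotpC. Qed.

Lemma loss_model N w :
  L2norm leb01 (model_estimator phi psi N (obs w) \- s) ^+ 2 =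
  bias phi psi s N + v * \sum_(i <- indices N) eps i w ^+ 2.
Proof.
rewrite model_estimatorE //; last exact: observation_linear.
rewrite dist_model // mulr_sumr; congr (_ + _); apply: eq_bigr => i _.
by rewrite observation_wave addrAC subrr add0r exprMn noise_scale_sqr.
Qed.

Variables (lambda : nat -> R) (j0 : nat -> int)
  (mhat : nat -> ((R -> R) -> R) -> nat) (m : nat).
Hypothesis mhat_argmin : selection_rule phi psi lambda j0 mhat.
Hypothesis mhat_measurable : forall N,
  measurable [set w : Omega | mhat n (obs w) = N].
Hypotheses (j0m : j0 n = m%:Z) (m_gt0 : (1 <= m)%N).
Notation Nhat w := (mhat n (obs w)).
Notation loss w := (L2norm leb01 (selected_estimator phi psi mhat n (obs w) \- s) ^+ 2).
Notation u := (lambda n / n%:R).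

Let n_sizes : sizes j0 n.
Proof. by split => //; exists 0%N; rewrite /collection /= j0m. Qed.

Lemma selected_lt w : (Nhat w < m)%N.
Proof. by have [] := mhat_argmin (obs w) n_sizes; rewrite /collection /= j0m. Qed.

Lemma selected_criterion w N : (N < m)%N ->
  criterion (fun i => theta i) (fun i => eps i w) c v (lambda n) (Nhat w) <=
  criterion (fun i => theta i) (fun i => eps i w) c v (lambda n) N.
Proof.
move=> Nm; have [_] := mhat_argmin (obs w) n_sizes.
move=> /(_ N); rewrite /collection /= j0m => /(_ Nm).
rewrite !penalizedE //; try exact: observation_linear.
rewrite /criterion.
by under eq_bigr do rewrite observation_wave;
  under [X in _ <= - X + _]eq_bigr do rewrite observation_wave.
Qed.

Lemma loss_selected w :
  loss w = bias phi psi s (Nhat w) + v * \sum_(i <- indices (Nhat w)) eps i w ^+ 2.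
Proof. by rewrite /selected_estimator loss_model. Qed.

(** The selected level takes finitely many values, each on a measurable event,
and given this level the loss is a polynomial in the noise coefficients. *)
Lemma measurable_loss : measurable_fun setT (fun w => loss w).
Proof.
have -> : (fun w => loss w) = fun w => \sum_(N < m)
    \1_[set w | Nhat w = N] w * (bias phi psi s N + v * \sum_(i <- indices N) eps i w ^+ 2).
  apply/funext => w; rewrite (bigD1 (Ordinal (selected_lt w))) //=.
  rewrite indicE mem_set // mul1r -loss_selected big1 ?addr0 //.
  move=> N NN; rewrite indicE memNset ?mul0r //= => E.
  by case/eqP: NN; apply: val_inj; rewrite /= E.
apply: measurable_sum => N; apply: measurable_funM.
  exact: measurable_indic.
apply: measurable_funD => //; apply: measurable_funM => //.
apply: measurable_sum => i; apply: measurable_funX; exact: measurable_funP.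
Qed.

Lemma risk_le (Y : Omega -> R) : P.-integrable setT (EFin \o Y) ->
  (forall w, loss w <= Y w) ->
  (risk W (selected_estimator phi psi mhat) n s <= (\int[P]_w Y w)%:E)%E.
Proof.
move=> Yi lY; rewrite /risk unlock /Rintegral fineK; last exact: integrable_fin_num.
apply: ge0_le_integral => //.
- by move=> w _; rewrite lee_fin sqr_ge0.
- by apply/measurable_EFinP; exact: measurable_loss.
- exact: measurable_int Yi.
- by move=> w _; rewrite lee_fin.
Qed.

Lemma integrable_loss (r : R) :
  (risk W (selected_estimator phi psi mhat) n s <= r%:E)%E ->
  P.-integrable setT (EFin \o (fun w => loss w)) /\ \int[P]_w loss w <= r.
Proof.
rewrite /risk unlock => Hr.
have li : P.-integrable setT (EFin \o (fun w => loss w)).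
  apply/integrableP; split; first by apply/measurable_EFinP; exact: measurable_loss.
  apply: le_lt_trans (ltry r); apply: le_trans Hr.
  rewrite le_eqVlt; apply/orP; left; apply/eqP; apply: eq_integral => w _ /=.
  by rewrite ger0_norm // sqr_ge0.
split => //; rewrite -lee_fin /Rintegral fineK //; exact: integrable_fin_num.
Qed.


Section risk_bounds.
Variable kappa : R.
Hypotheses (kappa_gt1 : 1 < kappa) (penalty_large : 4 * kappa < lambda n).
Notation C := (overselection_factor kappa).
Notation bias := (bias phi psi s).
Notation S j w := (\sum_(i <- level j) eps i w ^+ 2).
Notation deviation j w := ((S j w - (2 ^ j)%:R) ^+ 2).

Let kappa_gt0 : 0 < kappa.
Proof. exact: lt_trans kappa_gt1. Qed.

Let C_ge0 : 0 <= C.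
Proof. exact: overselection_factor_ge0. Qed.

Let v_gt0 : 0 < v.
Proof. by rewrite invr_gt0 ltr0n. Qed.

Let penalty_gt4 : 4 <= kappa^-1 * lambda n.
Proof. by rewrite mulrC ler_pdivlMr // ltW. Qed.

Let lambda_gt0 : 0 < lambda n.
Proof. by apply: lt_trans penalty_large; rewrite mulr_gt0. Qed.

Let pow2_gt0 j : (0 : R) < (2 ^ j)%:R.
Proof. by rewrite ltr0n expn_gt0. Qed.

Let deviation_mean j : P.-integrable setT (EFin \o (fun w => deviation j w)) /\
  \int[P]_w deviation j w = 2 * (2 ^ j)%:R.
Proof. by have := noise_energy_variance (uniq_level j); rewrite size_level. Qed.

Let signal_le N N' : (N <= N')%N ->
  \sum_(N <= j < N') \sum_(i <- level j) theta i ^+ 2 <= bias N.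
Proof. by move=> NN; rewrite (bias_split _ _ _ NN) lerDr bias_ge0. Qed.

Let sum_half m' : \sum_(j < m') ((2 ^ j)%:R : R)^-1 <= 2.
Proof.
suff : \sum_(j < m') ((2 ^ j)%:R : R)^-1 = 2 - 2 * ((2 ^ m')%:R)^-1.
  by move=> ->; rewrite lerBlDr lerDl mulr_ge0 // invr_ge0 ltW.
elim: m' => [|k IH]; first by rewrite big_ord0 expn0 invr1; ring.
rewrite big_ord_recr /= IH expnS natrM; field; by rewrite gt_eqF.
Qed.

(** The selected bias and all the levels of the noise can be controlled at once on
some outcome. By Chebyshev's inequality the noise of level [j] exceeds four
times its mean with probability at most [2 / (9 * 2 ^ j)], and the loss exceeds
[9 * r] with probability at most [1 / 9]; these bounds sum to at most
[4 / 9 + 1 / 9]. Rather than events, the proof uses the sum of the variables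
to which Markov's inequality would be applied. *)
Lemma good_outcome (r : R) : 0 < r ->
  (risk W (selected_estimator phi psi mhat) n s <= r%:E)%E ->
  exists N, [/\ (N < m)%N, bias N <= 9 * r &
    forall N', (N' < m)%N -> (2 ^ N)%:R <= (2 ^ N')%:R + C / u * bias N'].
Proof.
move=> r0 /integrable_loss[li lr].
pose a j : R := (9 * (2 ^ j)%:R ^+ 2)^-1.
have a_gt0 j : 0 < a j by rewrite invr_gt0 mulr_gt0 // exprn_gt0.
have [I1 E1] := integrable_linear_sum (index_enum 'I_m) (fun j : 'I_m => a j)
  (fun j : 'I_m => (deviation_mean j).1).
have [I2 E2] := integrable_linear 1 (9 * r)^-1 I1 li.
have [] := exists_lt1_of_mean_lt1 I2.
  rewrite E2 E1 mul1r.
  have H1 : \sum_(j < m) a j * \int[P]_w deviation j w <= 2 / 9 * 2.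
    apply: (@le_trans _ _ (\sum_(j < m) 2 / 9 * ((2 ^ j)%:R : R)^-1)).
      apply: ler_sum => j _; rewrite (deviation_mean j).2 /a le_eqVlt; apply/orP; left.
      by apply/eqP; field; rewrite gt_eqF.
    by rewrite -mulr_sumr ler_wpM2l // divr_ge0.
  have H2 : (9 * r)^-1 * \int[P]_w loss w <= 9^-1.
    by rewrite mulrC ler_pdivrMr ?mulr_gt0 // mulrA mulVf ?mul1r // pnatr_eq0.
  by apply: le_lt_trans (lerD H1 H2) _; lra.
move=> w; rewrite mul1r => Zw.
have sum_ge0 : 0 <= \sum_(j < m) a j * deviation j w.
  by apply: sumr_ge0 => j _; rewrite mulr_ge0 ?sqr_ge0 // ltW.
have loss_ge0 : 0 <= (9 * r)^-1 * loss w.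
  by rewrite mulr_ge0 ?sqr_ge0 // invr_ge0 mulr_ge0 // ltW.
exists (Nhat w); split; first exact: selected_lt.
- apply: (@le_trans _ _ (loss w)).
    rewrite loss_selected lerDl mulr_ge0 ?(ltW v_gt0) //.
    by apply: sumr_ge0 => i _; exact: sqr_ge0.
  have : (9 * r)^-1 * loss w < 1 by lra.
  by rewrite mulrC ltr_pdivrMr ?mulr_gt0 // mul1r => /ltW.
move=> N' N'm; have u0 : 0 < u by rewrite divr_gt0 // ltr0n.
have Cb0 : 0 <= C / u * bias N' by rewrite mulr_ge0 ?bias_ge0 // divr_ge0 // ltW.
have [NN|/ltnW NN] := leqP N' (Nhat w); last first.
  by apply: (@le_trans _ _ (2 ^ N')%:R); rewrite ?lerDl // ler_nat leq_exp2l.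
have noise_le j : (N' <= j < Nhat w)%N -> S j w <= kappa^-1 * lambda n * (2 ^ j)%:R + 0.
  move=> /andP[_ jN]; have jm := ltn_trans jN (selected_lt w).
  have aj : a j * deviation j w < 1.
    apply: le_lt_trans (_ : \sum_(k < m) a k * deviation k w < 1); last by lra.
    rewrite (bigD1 (Ordinal jm)) //= lerDl; apply: sumr_ge0 => k _.
    by rewrite mulr_ge0 ?sqr_ge0 // ltW.
  rewrite addr0; apply: (@le_trans _ _ (4 * (2 ^ j)%:R)); last first.
    by apply: ler_wpM2r => //; exact: ltW.
  move: aj; rewrite mulrC ltr_pdivrMr ?mulr_gt0 ?exprn_gt0 // mul1r.
  exact: le_of_small_deviation.
have := overselection_bound noise_scale_sqr (ltW v_gt0) kappa_gt1 NN
  (selected_criterion w N'm) noise_le (fun=> lexx 0).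
rewrite big1_eq mulr0 addr0 => H.
rewrite -lerBlDl mulrAC ler_pdivlMr // mulrC; apply: le_trans H _.
by apply: ler_wpM2l => //; exact: signal_le.
Qed.

(** Below the level [N'], the penalty controls the missed signal. Above it, the
additional variance is charged to the bias at [N'] or to the excess of noise,
whose mean is bounded at each level because the variance of the noise energy is
proportional to its mean: hence the term in [m]. *)
Lemma risk_oracle N' : (N' < m)%N ->
  (risk W (selected_estimator phi psi mhat) n s <=
   ((2 + C) * (bias N' + u * (2 ^ N')%:R + v * (2 ^ N')%:R + v * m%:R))%:E)%E.
Proof.
move=> N'm.
pose a j : R := (3 * (2 ^ j)%:R)^-1.
have a_gt0 j : 0 < a j by rewrite invr_gt0 mulr_gt0.
pose excess w j := a j * deviation j w.
have excess_ge0 w j : 0 <= excess w j by rewrite mulr_ge0 ?sqr_ge0 // ltW.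
have [I0 E0] := noise_energy_mean (indices N').
have [I1 E1] := integrable_linear_sum (index_enum 'I_m) (fun j : 'I_m => a j)
  (fun j : 'I_m => (deviation_mean j).1).
have [I2 E2] := integrable_linear ((2 + C) * v) ((2 + C) * v) I0 I1.
have [I3 E3] := integrable_linear 1 ((2 + C) * (bias N' + u * (2 ^ N')%:R)) I2
  (L2_integrable (L2_cst P 1)).
apply: le_trans (risk_le I3 _) _; last first.
  rewrite E3 E2 E1 E0 Rintegral_cst_prob size_indices lee_fin.
  have : \sum_(j < m) a j * \int[P]_w deviation j w <= m%:R.
    apply: (@le_trans _ _ (\sum_(j < m) (1 : R))); last by rewrite sumr_const card_ord.
    apply: ler_sum => j _; rewrite (deviation_mean j).2 /a.
    rewrite mulrC ler_pdivrMr ?mulr_gt0 // mul1r ler_wpM2r ?(ltW (pow2_gt0 j)) //; lra.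
  move=> Hm; have : (2 + C) * v * \sum_(j < m) a j * \int[P]_w deviation j w <= (2 + C) * v * m%:R.
    by apply: ler_wpM2l => //; rewrite mulr_ge0 ?addr_ge0 // ltW.
  by lra.
move=> w; rewrite /cst mulr1 mul1r.
pose T N := \sum_(i <- indices N) eps i w ^+ 2.
have T_split N1 N2 : (N1 <= N2)%N -> T N2 = T N1 + \sum_(N1 <= j < N2) S j w.
  exact: sum_indices_split.
have T_ge0 N : 0 <= T N by apply: sumr_ge0 => i _; exact: sqr_ge0.
have S_ge0 j : 0 <= S j w by apply: sumr_ge0 => i _; exact: sqr_ge0.
have R_ge0 : 0 <= \sum_(j < m) a j * deviation j w.
  by apply: sumr_ge0 => j _; exact: excess_ge0.
have v0 := ltW v_gt0; have b0 := bias_ge0 onb s_L2 N'.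
have u0 : 0 < u by rewrite divr_gt0 // ltr0n.
rewrite -/(T N'); set E := \sum_(j < m) a j * deviation j w.
have uD : 0 <= u * (2 ^ N')%:R by rewrite mulr_ge0 // ltW.
rewrite loss_selected -/(T (Nhat w)).
have [NN|/ltnW NN] := leqP N' (Nhat w).
  have noise_le j : (N' <= j < Nhat w)%N ->
      S j w <= kappa^-1 * lambda n * (2 ^ j)%:R + excess w j.
    move=> _; apply: (@le_trans _ _ (4 * (2 ^ j)%:R + excess w j)); last first.
      by rewrite lerD2r; apply: ler_wpM2r => //; exact: ltW.
    exact: le_excess.
  have := overselection_bound noise_scale_sqr v0 kappa_gt1 NN
    (selected_criterion w N'm) noise_le (excess_ge0 w).
  set TH := \sum_(N' <= j < Nhat w) \sum_(i <- level j) theta i ^+ 2.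
  set EX := \sum_(N' <= j < Nhat w) excess w j; set D := _ - _ => HD.
  have EXE : EX <= E.
    rewrite /EX /E -(big_mkord xpredT (excess w)).
    rewrite (big_cat_nat (leq0n N') (ltnW N'm)) /=.
    rewrite (big_cat_nat NN (ltnW (selected_lt w))) /= addrC -addrA lerDl.
    by rewrite addr_ge0 // sumr_ge0.
  have Sle : \sum_(N' <= j < Nhat w) S j w <= kappa^-1 * lambda n * D + EX.
    rewrite /D -sum_pow2 // mulr_sumr -big_split /=.
    by rewrite big_nat_cond [leRHS]big_nat_cond; apply: ler_sum => j /andP[/noise_le].
  have D_ge0 : 0 <= D by rewrite subr_ge0 ler_nat leq_exp2l.
  have kD : v * (kappa^-1 * lambda n * D) <= lambda n * v * D.
    have : kappa^-1 * (lambda n * v * D) <= lambda n * v * D.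
      rewrite ler_piMl ?invf_le1 ?(ltW kappa_gt1) //.
      by rewrite mulr_ge0 // mulr_ge0 // ltW.
    by apply: le_trans; rewrite le_eqVlt; apply/orP; left; apply/eqP; ring.
  have vS := ler_wpM2l v0 Sle; have vEX := ler_wpM2l v0 EXE.
  have THb : TH <= bias N' by exact: signal_le.
  rewrite (T_split _ _ NN).
  apply: (oracle_above_arith (D := lambda n * v * D)) => //; first exact: bias_le.
    by apply: le_trans vS _; rewrite mulrDr; exact: lerD.
  by apply: le_trans HD _; apply: ler_wpM2l => //; exact: lerD.
have Hy := criterion_ge NN (selected_criterion w N'm).
have THb : \sum_(Nhat w <= j < N') \sum_(i <- level j) theta i ^+ 2 <=
    2 * (u * (2 ^ N')%:R) + 2 * (v * \sum_(Nhat w <= j < N') S j w).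
  apply: (@le_trans _ _ (2 * \sum_(Nhat w <= j < N')
      \sum_(i <- level j) (theta i + c * eps i w) ^+ 2
    + 2 * (v * \sum_(Nhat w <= j < N') S j w))).
    rewrite !mulr_sumr -big_split /=; apply: ler_sum => j _.
    rewrite !mulr_sumr -big_split /=; apply: ler_sum => i _.
    rewrite -noise_scale_sqr -exprMn; exact: sqr_le_double.
  rewrite lerD2r ler_wpM2l //; apply: le_trans Hy _.
  apply: ler_wpM2l; first by rewrite mulr_ge0 // ltW.
  by rewrite lerBlDr lerDl ler0n.
rewrite (bias_split _ _ _ NN) (T_split _ _ NN).
by apply: oracle_below_arith => //; exact: sumr_ge0.
Qed.

End risk_bounds.

Lemma risk_crude :
  (risk W (selected_estimator phi psi mhat) n s <=
   (bias phi psi s 0 + v * (2 ^ m)%:R)%:E)%E.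
Proof.
have [I0 E0] := noise_energy_mean (indices m).
have [I1 E1] := integrable_linear 1 v (L2_integrable (L2_cst P (bias phi psi s 0))) I0.
apply: le_trans (risk_le I1 _) _; last first.
  by rewrite E1 E0 Rintegral_cst_prob mul1r size_indices.
move=> w; rewrite loss_selected /cst mul1r; apply: lerD; first exact: bias_le.
apply: ler_wpM2l; first by rewrite invr_ge0.
rewrite (sum_indices_split _ (ltnW (selected_lt w))) lerDl.
by apply: sumr_ge0 => j _; apply: sumr_ge0 => i _; exact: sqr_ge0.
Qed.

Lemma bias0_le_risk (r : R) : m = 1%N ->
  (risk W (selected_estimator phi psi mhat) n s <= r%:E)%E -> bias phi psi s 0 <= r.
Proof.
move=> m1 /integrable_loss[li lr]; apply: le_trans lr.
rewrite -(Rintegral_cst_prob P (bias phi psi s 0)); apply: le_Rintegral => //.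
  exact: (L2_integrable (L2_cst P _)).
move=> w _; rewrite loss_selected.
have := selected_lt w; rewrite m1 ltnS leqn0 => /eqP ->.
rewrite lerDl mulr_ge0 ?invr_ge0 //; apply: sumr_ge0 => i _; exact: sqr_ge0.
Qed.

End fixed_size.

End selected_model_loss.

(** * Maxisets and Besov balls *)

Section maxiset.
Context {R : realType}.
Variables phi psi : R -> R.
Hypothesis onb : orthonormal_basis leb01 (L2 leb01) (wave phi psi).
Context {d : measure_display} {Omega : measurableType d}.
Variables (P : probability Omega R) (W : (R -> R) -> {RV P >-> R}).
Hypothesis noise : white_noise (range (wave phi psi)) W.
Variables (alpha : R) (lambda : nat -> R) (j0 : nat -> int).
Hypothesis alpha_gt0 : 0 < alpha.
Hypothesis lambda_gt0 : forall n, (1 <= n)%N -> 0 < lambda n.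
Hypothesis lambda_mono : forall n n', (1 <= n)%N -> (n <= n')%N ->
  lambda n <= lambda n'.
Hypothesis lambda_lim : (fun n : nat => n%:R^-1 * lambda n) @ \oo --> (0 : R).
Hypothesis j0_mono : forall n n', (1 <= n)%N -> (n <= n')%N -> j0 n <= j0 n'.
Hypothesis j0_def : forall n, (1 <= n)%N ->
  (2 : R) ^ (j0 n) <= n%:R * (lambda n)^-1 /\
  n%:R * (lambda n)^-1 < (2 : R) ^ (j0 n + 1).
Variable kappa : R.
Hypothesis kappa_gt1 : 1 < kappa.
Hypothesis weights_lt1 : forall n m, (1 <= n)%N -> j0 n = m%:Z ->
  \sum_(N < m) expR (- ((Num.sqrt (kappa^-1 * lambda n) - 1) ^+ 2 * (2 ^ N)%:R / 2)) < 1.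
Variable mhat : nat -> ((R -> R) -> R) -> nat.
Hypothesis mhat_argmin : selection_rule phi psi lambda j0 mhat.
Hypothesis mhat_measurable : forall n s N, sizes j0 n -> L2 leb01 s ->
  measurable [set w : Omega | mhat n (observation W n s w) = N].

Notation shat := (selected_estimator phi psi mhat).
Notation rho := (rate lambda alpha).
Notation u n := (lambda n / n%:R).
Notation C := (overselection_factor kappa).
Notation bias := (bias phi psi).
Let w : R := (1 + 2 * alpha)^-1.
Let g : R := 2 * alpha * w.

Let a2_gt0 : 0 < 2 * alpha.
Proof. by rewrite mulr_gt0. Qed.

Let w_gt0 : 0 < w.
Proof. by rewrite invr_gt0 addr_gt0. Qed.

Let w_le1 : w <= 1.
Proof. by rewrite invf_le1 ?addr_gt0 // lerDl ltW. Qed.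

Let w_g : w + g = 1.
Proof. by rewrite /g /w; field; rewrite gt_eqF // addr_gt0. Qed.

Let g_gt0 : 0 < g.
Proof. by rewrite mulr_gt0. Qed.

Let g_lt1 : g < 1.
Proof. by rewrite -w_g ltrDr. Qed.

Let u_gt0 n : (1 <= n)%N -> 0 < u n.
Proof. by move=> n1; rewrite divr_gt0 ?lambda_gt0 // ltr0n. Qed.

Let rho_sqr n : (1 <= n)%N -> rho n ^+ 2 = u n `^ g.
Proof.
move=> n1; rewrite /rate expr2 -powRD; last by apply/implyP => _; rewrite gt_eqF ?u_gt0.
by congr (_ `^ _); rewrite /g /w; field; rewrite gt_eqF // addr_gt0.
Qed.

Let rho_sqr_gt0 n : (1 <= n)%N -> 0 < rho n ^+ 2.
Proof. by move=> n1; rewrite rho_sqr // powR_gt0 // u_gt0. Qed.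

Let maxiset_ballP M s : maxiset_ball W (sizes j0) shat rho M s <->
  L2 leb01 s /\ forall n, sizes j0 n -> (risk W shat n s <= (M ^+ 2 * u n `^ g)%:E)%E.
Proof.
have scale n (x : \bar R) : (1 <= n)%N ->
    (((rho n ^- 2)%:E * x <= (M ^+ 2)%:E) = (x <= (M ^+ 2 * u n `^ g)%:E))%E.
  by move=> n1; rewrite lee_pdivrMl ?rho_sqr_gt0 // rho_sqr // -EFinM mulrC.
split=> -[Ls H]; split => //.
  move=> n [n1 jn]; rewrite -scale //; apply: le_trans H.
  by apply: ereal_sup_ubound; exists n.
apply: ge_ereal_sup => _ [n nS <-]; rewrite scale; first exact: H.
by case: nS.
Qed.

Let besov_ballP M s : besov_ball phi psi alpha M s <-> L2 leb01 s /\
  forall J, (2 `^ (2 * alpha)) ^+ J *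
    (\sum_(i <- level J) dotp leb01 s (wave phi psi i) ^+ 2) <= M ^+ 2.
Proof.
have E J : 2 `^ (2 * J%:R * alpha) = (2 `^ (2 * alpha)) ^+ J :> R.
  by rewrite -mulrA [J%:R * _]mulrC mulrA powRrM powR_mulrn ?powR_ge0.
split=> -[Ls H]; split => //.
  move=> J; rewrite -E level_beta -lee_fin; apply: le_trans H.
  by apply: ereal_sup_ubound; exists J.
by apply: ge_ereal_sup => _ [J _ <-]; rewrite lee_fin E -level_beta.
Qed.

Let sizesP n : sizes j0 n -> exists m, j0 n = m%:Z /\ (1 <= m)%N.
Proof.
move=> [n1 [N]]; rewrite /collection /=; case: (j0 n) => // m Nm; exists m.
by split => //; apply: leq_ltn_trans Nm.
Qed.

Let level_bounds n m : (1 <= n)%N -> j0 n = m%:Z ->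
  (2 ^ m)%:R * u n <= 1 /\ 1 < (2 ^ m.+1)%:R * u n.
Proof.
move=> n1 jm; have [H1 H2] := j0_def n1; have l0 := lambda_gt0 n1.
have n0 : (0 : R) < n%:R by rewrite ltr0n.
rewrite jm -exprnP -natrX in H1.
rewrite jm -PoszD addn1 -exprnP -natrX in H2.
rewrite !mulrA ler_pdivrMr // ltr_pdivlMr // !mul1r.
by move: H1 H2; rewrite ler_pdivlMr // ltr_pdivrMr.
Qed.

Let large_size : exists n1, [/\ (1 <= n1)%N, forall n, (n1 <= n)%N -> 3 <= j0 n &
  forall n, (n1 <= n)%N -> 4 * kappa < lambda n].
Proof.
have [n1 [n1_gt0 j3]] := j0_unbounded lambda_gt0 lambda_lim j0_def 3.
have jn n : (n1 <= n)%N -> 3 <= j0 n by move=> nn; apply: le_trans j3 (j0_mono n1_gt0 nn).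
exists n1; split => // n nn.
by apply: (penalty_lower_bound lambda_gt0 kappa_gt1 weights_lt1) (jn n nn); exact: leq_trans nn.
Qed.

(** The sizes [nu * 2 ^ k] are large enough for the doubling condition and for
[good_outcome], which is applied at each of them with the level obtained at the
previous one. The low levels are bounded at a size [n2] where the model of
level [0] is alone. *)
Lemma maxiset_sub_besov (n0 : nat) (delta : R) :
    (1 <= n0)%N -> 0 < delta -> delta <= 1 / 2 ->
    (forall n, (n0 <= n)%N -> lambda (2 * n)%N <= 2 * (1 - delta) * lambda n) ->
  forall M, 0 < M -> exists M', 0 < M' /\
    maxiset_ball W (sizes j0) shat rho M `<=` besov_ball phi psi alpha M'.
Proof.
move=> n0_gt0 d0 d2 double M M0.
have [n1 [n1_gt0 jbig lbig]] := large_size.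
have [n2 [n2_gt0 jn2]] := j0_eq1 lambda_gt0 lambda_mono lambda_lim j0_mono j0_def
  kappa_gt1 weights_lt1.
pose nu := maxn n0 n1.
pose nk k := (nu * 2 ^ k)%N.
have nk_nu k : (nu <= nk k)%N by rewrite leq_pmulr // expn_gt0.
have nk_n0 k : (n0 <= nk k)%N by apply: leq_trans (nk_nu k); exact: leq_maxl.
have nk_n1 k : (n1 <= nk k)%N by apply: leq_trans (nk_nu k); exact: leq_maxr.
have nk_gt0 k : (1 <= nk k)%N by apply: leq_trans (nk_n0 k).
have nkS k : nk k.+1 = (2 * nk k)%N by rewrite /nk expnS mulnCA.
have /choice [mk Hmk] : forall k, exists m, j0 (nk k) = m%:Z /\ (1 <= m)%N.
  move=> k; have := jbig _ (nk_n1 k); case: (j0 _) => // m m3; exists m; split => //.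
  exact: leq_trans m3.
have nk_sizes k : sizes j0 (nk k).
  by split => //; exists 0%N; rewrite /collection /= (Hmk k).1; have := (Hmk k).2.
pose U k := u (nk k).
have U_gt0 k : 0 < U k by exact: u_gt0.
have UE k : U k.+1 = lambda (nk k.+1) / 2 / (nk k)%:R.
  rewrite /U {2}nkS natrM; field.
  by rewrite pnatr_eq0 -lt0n nk_gt0.
have nkR k : (0 : R) < (nk k)%:R by rewrite ltr0n.
have U_le k : U k.+1 <= (1 - delta) * U k.
  rewrite UE mulrA; apply: ler_wpM2r; first by rewrite invr_ge0 ltW.
  have := double _ (nk_n0 k); rewrite -nkS; lra.
have U_ge k : U k <= 2 * U k.+1.
  rewrite UE mulrA mulrCA divff // mulr1; apply: ler_wpM2r; first by rewrite invr_ge0 ltW.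
  by apply: lambda_mono => //; rewrite nkS leq_pmull.
have C0 : 0 <= C by exact: overselection_factor_ge0.
pose K := 9 * M ^+ 2.
have M2 : 0 < M ^+ 2 by rewrite exprn_gt0.
have K0 : 0 <= K by rewrite mulr_ge0 // ltW.
pose contr := 1 - (1 - delta) `^ (1 - g).
have contr0 : 0 < contr.
  rewrite subr_gt0 -[ltRHS](one_powR (1 - g)); apply: gt0_ltr_powR; rewrite ?subr_gt0 //.
  - by rewrite nnegrE; lra.
  - by rewrite nnegrE.
  - by lra.
(* [Z] dominates the initial dimension, bounded by that of the largest model,
   and the fixed point of the recursion on dimensions *)
pose Z := U 0%N * (2 ^ mk 0%N)%:R / U 0%N `^ g + C * K * 2 `^ g / contr + 1.
have Ug k : 0 < U k `^ g by rewrite powR_gt0.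
have Z1 : 0 <= U 0%N * (2 ^ mk 0%N)%:R / U 0%N `^ g.
  by apply: divr_ge0; [apply: mulr_ge0 => //|]; exact: ltW.
have Z2 : 0 <= C * K * 2 `^ g / contr.
  by apply: divr_ge0; [|exact: ltW]; apply: mulr_ge0; [exact: mulr_ge0|exact: powR_ge0].
have Z0 : 0 < Z by rewrite /Z; lra.
pose B0 := M ^+ 2 * u n2 `^ g.
have B00 : 0 <= B0 by rewrite mulr_ge0 ?powR_ge0 // ltW.
pose bound := B0 * (Z / U 0%N `^ w) `^ (2 * alpha) + K * 2 `^ g * Z `^ (2 * alpha).
have bound0 : 0 <= bound by apply: addr_ge0; repeat (apply: mulr_ge0 => //); exact: powR_ge0.
(* squaring the radius is harmless since [x <= (x + 1) ^+ 2] *)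
exists (bound + 1); split; first by rewrite ltr_wpDl.
move=> s /maxiset_ballP[Ls risk_s]; apply/besov_ballP; split => // J.
have M'b : bound <= (bound + 1) ^+ 2 by rewrite expr2; nra.
apply: le_trans M'b.
have good k := @good_outcome _ _ _ onb _ _ _ _ noise _ s (nk_gt0 k) Ls _ _ _ _
  mhat_argmin (fun N => mhat_measurable N (nk_sizes k) Ls) (Hmk k).1 (Hmk k).2
  _ kappa_gt1 (lbig _ (nk_n1 k)) _ (mulr_gt0 M2 (Ug k)) (risk_s _ (nk_sizes k)).
have /choice [N HN] := good.
have N_lt k : (N k < mk k)%N by have [] := HN k.
have mk_le k : (mk k <= mk k.+1)%N.
  have nkk : (nk k <= nk k.+1)%N by rewrite nkS leq_pmull.
  by have := j0_mono (nk_gt0 k) nkk; rewrite (Hmk k).1 (Hmk k.+1).1.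
have dim := @dimension_rate _ U N (bias s) g delta C K Z g_gt0 g_lt1 d0 d2 C0 K0 U_gt0 U_le U_ge.
have bN k : bias s (N k) <= K * U k `^ g.
  by have [_ H _] := HN k; rewrite /K -mulrA.
have NZ : forall k, U k * (2 ^ N k)%:R <= Z * U k `^ g.
  apply: dim => //.
  - by move=> k; have [_ _] := HN k.+1; apply; apply: leq_trans (N_lt k) (mk_le k).
  - rewrite -ler_pdivrMr //; apply: (@le_trans _ _ (U 0%N * (2 ^ mk 0%N)%:R / U 0%N `^ g)).
      apply: ler_wpM2r; first by rewrite invr_ge0 ltW.
      by apply: ler_wpM2l; rewrite ?(ltW (U_gt0 _)) // ler_nat leq_exp2l // ltnW.
    by rewrite /Z; lra.
  - exact: ltW.
  - by rewrite -/contr -ler_pdivrMr // /Z; lra.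
have bB : bias s 0 <= B0.
  have n2_sizes : sizes j0 n2 by split => //; exists 0%N; rewrite /collection /= jn2.
  exact: (@bias0_le_risk _ _ _ onb _ _ _ _ noise _ s n2_gt0 Ls _ _ _ _
    mhat_argmin (fun N => mhat_measurable N n2_sizes Ls) (jn2 : _ = 1%:Z) isT
    _ erefl (risk_s _ n2_sizes)).
have := @bias_rate _ U N (bias s) alpha w g delta K Z B0 alpha_gt0 w_gt0 erefl w_g d0 d2
  K0 Z0 U_gt0 U_le U_ge bN NZ (@bias_le _ phi psi s) (bias_ge0 onb Ls) bB B00 J.
apply: le_trans; apply: ler_wpM2l; first by rewrite exprn_ge0 // powR_ge0.
by rewrite biasS lerDr bias_ge0.
Qed.

(** The oracle inequality applies once the penalty exceeds [4 * kappa], that is,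
for all sizes but finitely many. For the latter any bound on the risk that is
uniform over the Besov ball will do, such as the one of [risk_crude]. *)
Lemma besov_sub_maxiset M' : 0 < M' -> exists M, 0 < M /\
  besov_ball phi psi alpha M' `<=` maxiset_ball W (sizes j0) shat rho M.
Proof.
move=> M'0; have [n1 [n1_gt0 jbig lbig]] := large_size.
have Q0 : 0 < 2 `^ (2 * alpha) :> R by rewrite powR_gt0.
have Q1 : 1 < 2 `^ (2 * alpha) :> R.
  rewrite -[ltLHS](one_powR (2 * alpha)); apply: gt0_ltr_powR; rewrite ?nnegrE //.
  by rewrite ltr1n.
set Q : R := 2 `^ (2 * alpha) in Q0 Q1 *.
pose q := Q^-1.
have q0 : 0 < q by rewrite invr_gt0.
have q1 : q < 1 by rewrite invf_lt1.
pose Cb := M' ^+ 2 / (1 - q).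
have Cb0 : 0 <= Cb by rewrite divr_ge0 ?sqr_ge0 // subr_ge0 ltW.
have C0 : 0 <= C by exact: overselection_factor_ge0.
pose A1 := Cb * 4 `^ (2 * alpha) + 1 + (2 `^ w - 1)^-1.
have A10 : 0 <= A1.
  apply: addr_ge0; first by rewrite addr_ge0 // mulr_ge0 // powR_ge0.
  rewrite invr_ge0 subr_ge0 -[leLHS](one_powR w).
  by apply: ge0_ler_powR; rewrite ?nnegrE ?(ltW w_gt0) // ler1n.
pose crude n := (Cb + n%:R^-1 * (2 ^ `|j0 n|)%:R) / u n `^ g.
have crude0 n : 0 <= crude n.
  by rewrite divr_ge0 ?powR_ge0 // addr_ge0 // mulr_ge0 ?invr_ge0 ?ler0n.
pose bound := (2 + C) * (2 * A1) + \sum_(n < n1) crude n.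
have b1 : 0 <= (2 + C) * (2 * A1) by rewrite !mulr_ge0 // addr_ge0.
have b2 : 0 <= \sum_(n < n1) crude n by apply: sumr_ge0 => n _.
have bound0 : 0 <= bound by rewrite addr_ge0.
exists (bound + 1); split; first by rewrite ltr_wpDl.
move=> s /besov_ballP[Ls levs]; apply/maxiset_ballP; split => // n nS.
have [m [jm m1]] := sizesP nS; have n_gt0 : (1 <= n)%N by case: nS.
have ug0 : 0 < u n `^ g by rewrite powR_gt0 // u_gt0.
have bE N : Q ^+ N * bias s N <= Cb.
  have := @geometric_bias _ (bias s) _ q (M' ^+ 2) q0 q1 (biasS phi psi s)
    (@bias_le _ phi psi s) (bias_vanishing onb Ls).
  have QN : 0 < Q ^+ N by rewrite exprn_gt0.
  move=> /(_ _ N); rewrite exprVn => H; rewrite mulrC -ler_pdivlMr //; apply: H => J.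
  by rewrite exprVn ler_pdivlMr ?exprn_gt0 // mulrC.
have M2 : bound <= (bound + 1) ^+ 2 by rewrite expr2; nra.
have meas := fun N => mhat_measurable N nS Ls.
suff: (risk W shat n s <= (bound * u n `^ g)%:E)%E.
  move=> H; apply: le_trans H _; rewrite lee_fin; apply: ler_wpM2r => //; exact: ltW.
have [nn|nn] := leqP n1 n; last first.
  apply: le_trans (risk_crude onb noise n_gt0 Ls mhat_argmin meas jm m1) _.
  rewrite lee_fin -ler_pdivrMr //; apply: (@le_trans _ _ (crude n)).
    rewrite /crude jm absz_nat; apply: ler_wpM2r; first by rewrite invr_ge0 ltW.
    by rewrite lerD2r; have := bE 0%N; rewrite expr0 mul1r.
  rewrite /bound (bigD1 (Ordinal nn)) //= addrCA lerDl addr_ge0 //.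
  by apply: sumr_ge0 => k _.
have [b_le b_gt] := level_bounds n_gt0 jm.
have [N [Nm HN]] := oracle_rate alpha_gt0 w_gt0 w_le1 erefl w_g Cb0 m1 (u_gt0 n_gt0) b_le b_gt bE.
apply: le_trans (risk_oracle onb noise n_gt0 Ls mhat_argmin meas jm m1 kappa_gt1 (lbig _ nn) Nm) _.
rewrite lee_fin; apply: (@le_trans _ _ ((2 + C) * (2 * A1) * u n `^ g)); last first.
  by apply: ler_wpM2r; [exact: ltW | rewrite lerDl].
rewrite -[leRHS]mulrA; apply: ler_wpM2l; first by rewrite addr_ge0.
have vu : n%:R^-1 <= u n.
  rewrite ler_peMl ?invr_ge0 //; have := lbig _ nn; have := kappa_gt1; lra.
have v1 : n%:R^-1 * (2 ^ N)%:R <= u n * (2 ^ N)%:R by apply: ler_wpM2r.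
have v2 : n%:R^-1 * m%:R <= u n * m%:R by apply: ler_wpM2r.
have v0 : 0 <= u n * m%:R by rewrite mulr_ge0 // ltW // u_gt0.
have bs0 := bias_ge0 onb Ls N.
rewrite -/A1 in HN; lra.
Qed.

End maxiset.

Theorem proposition3 (R : realType)
    (* the wavelet basis *)
    (r : nat) (phi psi : R -> R)
    (r_ge1 : (1 <= r)%N) (wavelets : wavelet_setting r phi psi)
    (* the Gaussian white noise *)
    (d : measure_display) (Omega : measurableType d) (P : probability Omega R)
    (W : (R -> R) -> {RV P >-> R})
    (noise : white_noise (range (wave phi psi)) W)
    (* the penalty and the maximal resolution level *)
    (alpha : R) (alpha_gt0 : 0 < alpha) (alpha_ltr : alpha < r%:R)
    (lambda : nat -> R)
    (lambda_gt0 : forall n, (1 <= n)%N -> 0 < lambda n)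
    (lambda_mono : forall n n', (1 <= n)%N -> (n <= n')%N ->
       lambda n <= lambda n')
    (lambda_lim : (fun n : nat => n%:R^-1 * lambda n) @ \oo --> (0 : R))
    (lambda_double : exists (n0 : nat) (delta : R),
       [/\ (1 <= n0)%N, 0 < delta, delta <= 1 / 2 &
           forall n, (n0 <= n)%N -> lambda (2 * n)%N <= 2 * (1 - delta) * lambda n])
    (j0 : nat -> int)
    (j0_mono : forall n n', (1 <= n)%N -> (n <= n')%N -> j0 n <= j0 n')
    (j0_def : forall n, (1 <= n)%N ->
       (2 : R) ^ (j0 n) <= n%:R * (lambda n)^-1 /\
       n%:R * (lambda n)^-1 < (2 : R) ^ (j0 n + 1))
    (exp_sum : exists kappa p : R,
       [/\ 1 < kappa, 0 < p, p < 1 & forall n, (1 <= n)%N ->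
         \sum_(N \in collection (j0 n))
            expR (- ((Num.sqrt (kappa^-1 * lambda n) - 1) ^+ 2
                     * (model_dim phi psi N)%:R / 2))
         <= Num.sqrt (1 - p)])
    (* the selected model *)
    (mhat : nat -> ((R -> R) -> R) -> nat)
    (mhat_argmin : selection_rule phi psi lambda j0 mhat)
    (mhat_measurable : forall n s N, sizes j0 n -> L2 leb01 s ->
       measurable [set w : Omega | mhat n (observation W n s w) = N]) :
  same_balls
    (maxiset_ball W (sizes j0) (selected_estimator phi psi mhat)
       (rate lambda alpha))
    (besov_ball phi psi alpha).
Proof.
have onb := wave_basis wavelets.
have [n0 [delta [n0_gt0 delta_gt0 delta_le double]]] := lambda_double.
have [kappa [p [kappa_gt1 p_gt0 p_lt1 weights]]] := exp_sum.
have weights_lt1 n m : (1 <= n)%N -> j0 n = m%:Z -> \sum_(N < m)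
    expR (- ((Num.sqrt (kappa^-1 * lambda n) - 1) ^+ 2 * (2 ^ N)%:R / 2)) < 1.
  move=> n_gt0 jm; have := weights n n_gt0.
  have -> : collection (j0 n) = `I_m by rewrite jm; apply/seteqP; split.
  rewrite -fsbig_ord; under eq_bigr do rewrite model_dimE //.
  move=> /le_lt_trans; apply.
  by rewrite -[ltRHS]sqrtr1 ltr_sqrt //; lra.
split.
  exact: (maxiset_sub_besov onb noise alpha_gt0 lambda_gt0 lambda_mono lambda_lim
    j0_mono j0_def kappa_gt1 weights_lt1 mhat_argmin mhat_measurable
    n0_gt0 delta_gt0 delta_le double).
exact: (besov_sub_maxiset onb noise alpha_gt0 lambda_gt0 lambda_lim
  j0_mono j0_def kappa_gt1 weights_lt1 mhat_argmin mhat_measurable).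
Qed.
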